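(* Let $Q$ be a non-degenerate quadratic form on $\mathbb{F}_q^d$, let $t\in\mathbb{F}_q^*$, and let $\mathcal{E}\subseteq\mathbb{F}_q^d$ (depending on $q$, with $d,k$ fixed, as $q\to\infty$). (1) If $k$ is even and $q^{\frac{d+1}{2}}\Lambda_k(\mathcal{E})=o(|\mathcal{E}|^k)$, then \[|\{(\mathbf{x}_1,\ldots,\mathbf{x}_k)\in\mathcal{E}^k:Q(\mathbf{x}_1+\cdots+\mathbf{x}_k)=t\}|=(1+o(1))\frac{|\mathcal{E}|^k}{q}.\] (2) If $k$ is odd and $q^{\frac{d+1}{2}}(\Lambda_{k-1}(\mathcal{E}))^{1/2}(\Lambda_{k+1}(\mathcal{E}))^{1/2}=o(|\mathcal{E}|^k)$, then the same conclusion holds.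
   Context: For even $\ell=2m\ge2$, the $\ell$-energy is $\Lambda_\ell(\mathcal{E})=|\{(\mathbf{x}^1,\ldots,\mathbf{x}^\ell)\in\mathcal{E}^\ell:\mathbf{x}^1+\cdots+\mathbf{x}^m=\mathbf{x}^{m+1}+\cdots+\mathbf{x}^\ell\}|$. $X=o(Y)$ means $X/Y\to0$ as $q\to\infty$. *)

(* Defs.v *)
From HB Require Import structures.
From mathcomp Require Import all_boot all_order all_algebra.
From mathcomp Require Import all_classical all_reals all_analysis.
From mathcomp Require Import ring.

Set Implicit Arguments.
Unset Strict Implicit.
Unset Printing Implicit Defensive.

Import Order.TTheory GRing.Theory Num.Theory.
Import numFieldNormedType.Exports.

Local Open Scope ring_scope.

Definition is_quadratic_form (F : fieldType) (d : nat) (Q : 'rV[F]_d -> F) : Prop :=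
  exists A : 'M[F]_d, forall x, Q x = \sum_i \sum_j A i j * x 0 i * x 0 j.

Definition polar (F : fieldType) (d : nat) (Q : 'rV[F]_d -> F)
    (x y : 'rV[F]_d) : F :=
  Q (x + y) - Q x - Q y.

(* No nonzero vector of the radical of the polar form is a zero of Q; over a
   finite field this says that Q is not equivalent to a form in fewer variables.
   The condition Q x = 0 matters only in characteristic 2, where it admits forms
   in an odd number of variables; see nondegenerate_formP. *)
Definition nondegenerate_form (F : fieldType) (d : nat) (Q : 'rV[F]_d -> F) : Prop :=
  forall x, (forall y, polar Q x y = 0) -> Q x = 0 -> x = 0.

Lemma nondegenerate_formP (F : fieldType) (d : nat) (Q : 'rV[F]_d -> F) :
  (2 : F) != 0 -> is_quadratic_form Q ->
  nondegenerate_form Q <-> (forall x, (forall y, polar Q x y = 0) -> x = 0).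
Proof.
move=> two0 [A QA]; split=> [ndQ x xrad | ndB x xrad _]; last exact: ndB.
apply: ndQ => //; apply: (mulfI two0); rewrite mulr0 -(xrad x) /polar.
have -> : Q (x + x) = 4 * Q x; last by ring.
rewrite !QA mulr_sumr; apply: eq_bigr => i _.
rewrite mulr_sumr; apply: eq_bigr => j _.
by rewrite !mxE; ring.
Qed.

(* For even l only. *)
Definition energy (V : finZmodType) (l : nat) (E : {set V}) : nat :=
  #|[set x : {ffun 'I_l -> V} | [forall i, x i \in E] &&
      (\sum_(i < l | (i < l./2)%N) x i == \sum_(i < l | (l./2 <= i)%N) x i)]%SET|.

Definition level_count (F : finFieldType) (d k : nat) (Q : 'rV[F]_d -> F)
    (t : F) (E : {set 'rV[F]_d}) : nat :=
  #|[set x : {ffun 'I_k -> 'rV[F]_d} | [forall i, x i \in E] &&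
      (Q (\sum_i x i) == t)]%SET|.

Definition little_o (R : realType) (X Y : nat -> R) : Prop :=
  (X n / Y n @[n --> \oo] --> (0 : R))%classic.

(* X = (1 + o(1)) Y *)
Definition asymp_eq (R : realType) (X Y : nat -> R) : Prop :=
  exists2 eps : nat -> R, (eps n @[n --> \oo] --> (0 : R))%classic &
    forall n, X n = (1 + eps n) * Y n.

(* Main.v *)
Require Import Defs.
From HB Require Import structures.
From mathcomp Require Import all_boot all_order all_algebra all_fingroup all_solvable.
From mathcomp Require Import all_field all_character qfpoly.
From mathcomp Require Import zify ring lra.
From mathcomp Require Import all_classical all_reals all_analysis.

(* Write [q = #|F|] and [k = m + n] with [m = n] or [n = m + 1], and let [r_m v]
   count the representations of [v] as a sum of [m] elements of [E]. Then
   [q N - |E|^k] is the bilinear form [sum_(u, v) r_m u * r_n v * phi (u + v)],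
   with [phi w = q * 1_(Q w = t) - 1]. Diagonalized by the characters of [F^d],
   it is at most [max |phi^| * sqrt (L_(2m) * L_(2n))], where [L] is the energy.
   Completing the square turns [phi^] into a Kloosterman sum twisted by quadratic
   Gauss sums, and Weil's bound for Kloosterman sums makes it
   [O (q^((d+1)/2))]. In characteristic 2 with [d] odd the polar form is
   degenerate, but then at each frequency at most one Gauss sum survives.

   Weil's bound, with constant 3 in place of 2, is obtained as follows. Over the
   quadratic extension the Kloosterman sum [S] becomes [2 q - S ^ 2], so in a tower
   of quadratic extensions a ratio [|S| / sqrt q] exceeding 3 grows without bound.
   On the other hand Stepanov's method over the field with [q^(2 s)] elements
   bounds by [q^(2 s - 1) + 5 q^s] each fiber of the trace of [x + c / x], hence
   bounds that ratio by [6 q], uniformly in [s]. *)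

Set Implicit Arguments.
Unset Strict Implicit.
Unset Printing Implicit Defensive.

Import Order.TTheory GRing.Theory Num.Theory.
Import numFieldNormedType.Exports.

Local Open Scope ring_scope.

(** * Stepanov's method *)

(** The degrees strictly increase with [n], so nothing cancels the leading coefficient of the last
    term with a nonzero scalar. *)
Lemma lin_comb_graded_neq0 (K : fieldType) (N d : nat) (P : nat -> {poly K})
    (c : nat -> K) :
  (forall n, size (P n) = (n + d).+1) ->
  (exists2 n, (n < N)%N & c n != 0) ->
  \sum_(n < N) c n *: P n != 0.
Proof.
move=> sP; elim: N => [|N IH] [n ltnN cn0]; first by [].
have small m (c' : nat -> K) : (size (\sum_(n < m) c' n *: P n)%R <= m + d)%N.
  apply: (leq_trans (size_sum _ _ _)); apply/bigmax_leqP => i _.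
  by apply: (leq_trans (size_scale_leq _ _)); rewrite sP ltn_add2r.
rewrite big_ord_recr /=; case: (eqVneq (c N) 0) => [cN0|cN0].
  rewrite cN0 scale0r addr0; apply: IH; exists n => //.
  by move: ltnN; rewrite ltnS leq_eqVlt => /orP[/eqP nN|//]; rewrite nN cN0 eqxx in cn0.
rewrite -size_poly_eq0 addrC size_polyDl ?size_scale // sP //.
by rewrite ltnS small.
Qed.

Lemma pigeonhole_additive (aT rT : finZmodType) (f : aT -> rT) :
  {morph f : x y / x - y} -> (#|rT| < #|aT|)%N ->
  exists2 x, x != 0 & f x = 0.
Proof.
move=> fB lt_card; have : ~~ injectiveb f.
  by apply/negP => /injectiveP /leq_card; rewrite leqNgt lt_card.
case/injectivePn=> x [y neq_xy fxy]; exists (x - y); first by rewrite subr_eq0.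
by rewrite fB fxy subrr.
Qed.

(* With [w = x^b * u], the equation says [u ^ B = a - u]. The auxiliary polynomial
   [H] is a combination of monomials [x^(al + ii * B) * u^jj], cleared of
   denominators; since [x^(B * B) = x], on the solutions [H ^ B] agrees up to a power
   of [x] with a polynomial of degree about [b * B], which the pigeonhole
   principle makes vanish identically. *)
Lemma stepanov_count (K : finFieldType) (b q : nat) (a : K) (w : {poly K})
    (B := (b * q)%N) :
  (0 < b)%N -> (1 < q)%N -> #|K| = (B * B)%N ->
  {morph (fun x : K => x ^+ B) : x y / x + y >-> x + y} ->
  size w = (b + b).+1 ->
  (#|[pred x : K | (x != 0%R) &&
       (w.[x] ^+ B == x ^+ (b * B.-1) * (a * x ^+ b - w.[x]))%R]| <=
     b * B + 5 * B)%N.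
Proof.
move=> b_gt0 q_gt1 cardK frobD sw.
have B_gt0 : (0 < B)%N by rewrite /B; nia.
have cardKx (x : K) : x ^+ (B * B) = x by rewrite -cardK expf_card.
have frob0 : (0 : K) ^+ B = 0 by rewrite expr0n gtn_eqF.
have frobB (x y : K) : (x - y) ^+ B = x ^+ B - y ^+ B.
  by apply/eqP; rewrite eq_sym subr_eq -frobD subrK.
have frob_sum (I : finType) (h : I -> K) : (\sum_i h i) ^+ B = \sum_i h i ^+ B.
  exact: (big_morph _ frobD frob0).
(* [N = b * q * (b + 4)] is the number of exponent triples [(al, jj, ii)], and [M] bounds the sizes
   of the [Z n] below. The 4 in [b + 4] leaves room for [M < N]. *)
pose N := ((b + 4) * B)%N; pose M := (b * B + B + 4)%N.
pose al n := (n %% b)%N; pose jj n := ((n %/ b) %% q)%N; pose ii n := (n %/ b %/ q)%N.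
have digits n : (n = al n + jj n * b + ii n * B)%N.
  rewrite /al /jj /ii /B {1}(divn_eq n b) {1}(divn_eq (n %/ b) q); ring.
have al_lt n : (al n < b)%N by rewrite ltn_mod.
have jj_lt n : (jj n < q)%N by rewrite ltn_mod (ltn_trans _ q_gt1).
have ii_lt n : (n < N)%N -> (ii n < b + 4)%N.
  by move=> ltnN; rewrite /ii -divnMA ltn_divLR.
(* [P n] is the monomial [x^(al + ii * B) * u^jj] times the common denominator [x^(q.-1 * b)]; the
   mixed-radix digits of [n] give it degree [n + q.-1 * b]. On the solutions, [Z n] is its [B]-th
   power stripped of the factor [x^(q.-1 * b * B.-1)], which does not depend on [n]. *)
pose P n : {poly K} := 'X^(al n + ii n * B + (q.-1 - jj n) * b) * w ^+ jj n.
pose Z n : {poly K} :=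
  'X^(al n * B + ii n + (q.-1 - jj n) * b) * (a *: 'X^b - w) ^+ jj n.
have w_neq0 : w != 0 by rewrite -size_poly_eq0 sw.
have sP n : size (P n) = (n + q.-1 * b).+1.
  rewrite /P mulrC size_mulXn ?expf_neq0 // -(prednK (_ : 0 < size _)%N);
    last by rewrite size_poly_gt0 expf_neq0.
  rewrite size_exp sw /= [in RHS](digits n).
  have := jj_lt n; move: (jj n) => j ltj; rewrite addnS; congr _.+1.
  have -> : q.-1 = (q.-1 - j + j)%N by lia.
  by rewrite addnK; ring.
have sZ n : (n < N)%N -> (size (Z n) <= M)%N.
  move=> ltnN; apply: (leq_trans (size_polyMleq _ _)).
  rewrite size_polyXn addSn /=.
  have s1 : (size (a *: 'X^b - w)%R <= (b + b).+1)%N.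
    apply: (leq_trans (size_polyD _ _)); rewrite geq_max size_polyN sw leqnn andbT.
    by apply: (leq_trans (size_scale_leq _ _)); rewrite size_polyXn ltnS leq_addr.
  have s2 : (size ((a *: 'X^b - w) ^+ jj n)%R <= ((b + b) * jj n).+1)%N.
    apply: (leq_trans (size_poly_exp_leq _ _)); rewrite ltnS leq_mul2r.
    by rewrite -subn1 leq_subLR add1n s1 orbT.
  apply: (leq_trans (leq_add (leqnn _) s2)).
  have := al_lt n; have := jj_lt n; have := ii_lt _ ltnN.
  rewrite /M; move: (al n) (jj n) (ii n) => k j i lti ltj ltk.
  have k_le : (k * B <= b.-1 * B)%N by rewrite leq_mul2r; lia.
  have bB : (b.-1 * B + B = b * B)%N by rewrite -[in RHS](prednK b_gt0) mulSn addnC.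
  have j_le : (j * b <= q.-1 * b)%N by rewrite leq_mul2r; lia.
  have qb : (q.-1 * b + b = B)%N.
    by rewrite /B -[in RHS](prednK (ltnW q_gt1)) mulnS mulnC addnC.
  have -> : ((b + b) * j = j * b + j * b)%N by ring.
  have -> : ((q.-1 - j) * b = q.-1 * b - j * b)%N by rewrite mulnBl.
  by lia.
have MN : (M < N)%N by rewrite /M /N /B; nia.
have eqPZ n (x : K) : w.[x] ^+ B = x ^+ (b * B.-1) * (a * x ^+ b - w.[x]) ->
    (P n).[x] ^+ B = x ^+ (q.-1 * b * B.-1) * (Z n).[x].
  move=> wx.
  rewrite /P /Z !hornerM !horner_exp hornerD hornerN hornerZ !horner_exp !hornerX exprMn.
  rewrite (exprAC w.[x]) wx exprMn mulrA [RHS]mulrA -!exprM -!exprD; congr (_ * _).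
  have -> : x ^+ ((al n + ii n * B + (q.-1 - jj n) * b) * B + b * B.-1 * jj n) =
     x ^+ (al n * B + (q.-1 - jj n) * b * B + b * B.-1 * jj n) * x ^+ ii n.
    rewrite -[in X in _ * X](cardKx x) -exprM -exprD; congr (x ^+ _); ring.
  rewrite -exprD; congr (x ^+ _).
  have := jj_lt n; move: (jj n) => j ltj.
  have -> : q.-1 = (q.-1 - j + j)%N by lia.
  by rewrite addnK; have := prednK B_gt0; move: B.-1 => B' <-; ring.
(* The coefficients enter through their [B]-th powers, so these conditions are additive in [c] but
   not linear: vectors are counted instead of dimensions. *)
pose f (c : 'rV[K]_N) : 'rV[K]_M := \row_m \sum_(n < N) c 0 n ^+ B * (Z n)`_m.
have fB : {morph f : x y / x - y}.
  move=> c c'; apply/rowP => m; rewrite !mxE -sumrB; apply: eq_bigr => n _.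
  by rewrite !mxE frobB mulrBl.
have [|c c_neq0 fc0] := pigeonhole_additive fB.
  by rewrite !card_mx !mul1n ltn_exp2l // cardK /B; nia.
pose e n := if insub n is Some i then c 0 i else 0.
have eE (n : 'I_N) : e n = c 0 n by rewrite /e valK.
pose H := \sum_(n < N) e n *: P n.
have H_neq0 : H != 0.
  apply: (lin_comb_graded_neq0 sP).
  by have [n cn0] := rV0Pn _ c_neq0; exists n; rewrite ?eE.
have sumZ0 : \sum_(n < N) c 0 n ^+ B *: Z n = 0.
  apply/polyP => m; rewrite coef0 coef_sum.
  under eq_bigr do rewrite coefZ.
  have [ltmM|leMm] := ltnP m M.
    by have /rowP/(_ (Ordinal ltmM)) := fc0; rewrite !mxE.
  by rewrite big1 // => n _; rewrite nth_default ?mulr0 // (leq_trans (sZ _ _)).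
pose rs := enum [pred x : K | (x != 0) &&
       (w.[x] ^+ B == x ^+ (b * B.-1) * (a * x ^+ b - w.[x]))].
have roots_rs : all (root H) rs.
  apply/allP => x; rewrite mem_enum inE => /andP[x0 /eqP wx].
  have : H.[x] ^+ B = 0.
    rewrite horner_sum frob_sum.
    transitivity (x ^+ (q.-1 * b * B.-1) * (\sum_(n < N) c 0 n ^+ B *: Z n).[x]).
      rewrite horner_sum mulr_sumr; apply: eq_bigr => n _.
      by rewrite !hornerZ exprMn eqPZ // eE mulrCA.
    by rewrite sumZ0 horner0 mulr0.
  by move/eqP; rewrite expf_eq0 => /andP[_].
have := max_poly_roots H_neq0 roots_rs (enum_uniq _).
rewrite -cardE; set nx := #|_| => lt_nx.
(* As [q.-1 * b <= B], this size is at most [(b + 4) * B + B], whence the constant 5. *)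
have sH : (size H <= N + q.-1 * b)%N.
  apply: (leq_trans (size_sum _ _ _)); apply/bigmax_leqP => n _.
  apply: (leq_trans (size_scale_leq _ _)); rewrite sP.
  by have := ltn_ord n; lia.
have := leq_trans lt_nx sH.
have : (q.-1 * b <= B)%N by rewrite /B mulnC leq_mul2l leq_pred orbT.
rewrite /N mulnDl; lia.
Qed.

(** * Additive characters *)

Definition is_addchar (V : zmodType) (psi : V -> algC) : Prop :=
  [/\ psi 0 = 1, {morph psi : x y / x + y >-> x * y} & forall x, `|psi x| = 1].

(** The additive group of [F] is abelian, so it has as many irreducible characters as elements, all
    of them linear; at least one is not the trivial character. *)
Lemma exists_nontrivial_addchar (F : finFieldType) :
  exists2 psi : F -> algC, is_addchar psi & exists x, psi x != 1.
Proof.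
have ab : abelian [set: F] := FinRing.zmod_abelian _.
have [i i_neq0] : exists i : Iirr [set: F], i != 0.
  apply/existsP; apply: contraLR (finNzRing_gt1 F) => /existsPn i0.
  rewrite -leqNgt -cardsT -(card_Iirr_abelian ab).
  have i0E (j : Iirr [set: F]) : j = 0 by apply/eqP; have := i0 j; rewrite negbK.
  by apply/card_le1P => j _ k; rewrite !inE (i0E j) (i0E k) eqxx.
have lin : 'chi_i \is a linear_char by apply/char_abelianP.
exists ('chi_i : F -> algC).
  split=> [|x y|x].
  - by rewrite -[RHS](lin_char1 lin).
  - by rewrite -lin_charM ?inE.
  - by rewrite normC_lin_char ?inE.
have : 'chi_i != 1 by rewrite -irr0 (inj_eq irr_inj).
move/eqP/cfunP => H.
apply/existsP; apply: contra_notT H => /existsPn H x.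
by rewrite cfun1E inE; apply/eqP; have := H x; rewrite negbK.
Qed.

Lemma addcharN (V : zmodType) (psi : V -> algC) x :
  is_addchar psi -> psi (- x) = (psi x)^*.
Proof.
case=> psi0 psiD psi_norm.
have x0 : psi x != 0 by rewrite -normr_eq0 psi_norm oner_eq0.
apply: (mulfI x0); rewrite -psiD subrr psi0.
by rewrite -normCK psi_norm expr1n.
Qed.

Lemma addchar_comp (U V : zmodType) (psi : V -> algC) (h : U -> V) :
  h 0 = 0 -> {morph h : x y / x + y} -> is_addchar psi -> is_addchar (psi \o h).
Proof.
move=> h0 hD [psi0 psiD psi1]; split=> [|x y|x] /=; by rewrite ?h0 ?hD.
Qed.

Lemma addchar_sum_nontrivial (V : finZmodType) (psi : V -> algC) y :
  is_addchar psi -> psi y != 1 -> \sum_x psi x = 0.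
Proof.
move=> [_ psiD _] y1.
have e : psi y * (\sum_x psi x) = \sum_x psi x.
  rewrite [RHS](reindex_inj (addrI y)) mulr_sumr.
  by apply: eq_bigr => x _; rewrite psiD.
have /eqP := e; rewrite -[X in _ == X]mul1r -subr_eq0 -mulrBl mulf_eq0 subr_eq0.
by rewrite (negPf y1) => /eqP.
Qed.

Lemma addchar_sum_scaled (F : finFieldType) (psi : F -> algC) (a : F) :
  is_addchar psi -> (exists y, psi y != 1) ->
  \sum_x psi (a * x) = if a == 0 then #|F|%:R else 0.
Proof.
move=> hpsi [y y1]; case: eqP => [->|/eqP a0].
  under eq_bigr do rewrite mul0r (let: And3 p _ _ := hpsi in p).
  by rewrite sumr_const.
apply: (@addchar_sum_nontrivial _ (psi \o *%R a) (a^-1 * y)) => /=.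
  by apply: addchar_comp hpsi; [rewrite mulr0 | exact: mulrDr].
by rewrite mulrA mulfV // mul1r.
Qed.

(** * Kloosterman sums *)

(** The map [x |-> x * (y - x)] takes the value 0 at both 0 and [y]; not being injective on a finite
    set, it misses a value. *)
Lemma exists_rootless_quadratic (F : finFieldType) (y : F) :
  y != 0 -> exists a, forall x, x * (y - x) != a.
Proof.
move=> y0; pose f (x : F) : F := x * (y - x).
have [/forallP fsurj|/forallPn[a]] := boolP [forall a, a \in codom f]; last first.
  by move=> fNa; exists a => x; apply: contraNneq fNa => <-; apply: codom_f.
have finj : {in F &, injective f}.
  by apply/image_injP/eqP/eq_card => a; rewrite fsurj.
have f0y : f 0 = f y by rewrite /f mul0r subrr mulr0.
by have /eqP := finj 0 y isT isT f0y; rewrite eq_sym (negPf y0).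
Qed.

(** Some [X^2 - X + a] has no root, hence is irreducible; this shape works in every
    characteristic. *)
Lemma exists_quadratic_extension (F : finFieldType) :
  exists (K : finFieldType) (iota : {rmorphism F -> K}), #|K| = (#|F| ^ 2)%N.
Proof.
have [a noroot] := @exists_rootless_quadratic F 1 (oner_neq0 _).
pose p : {poly F} := 'X^2 - 'X + a%:P.
have sp2 : (size (- 'X + a%:P : {poly F})%R < size ('X^2 : {poly F})%R)%N.
  rewrite size_polyXn; apply: (leq_ltn_trans (size_polyD _ _)).
  by rewrite size_polyN size_polyX size_polyC; case: (a != 0).
have sp : size p = 3 by rewrite /p -addrA size_polyDl // size_polyXn.
have mp : p \is monic by rewrite monicE /p -addrA lead_coefDl // lead_coefXn.
have ip : irreducible_poly p.
  apply: cubic_irreducible; first by rewrite sp.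
  move=> x; apply/negP => /rootP; rewrite !hornerE => px; have /negP[] := noroot x.
  by rewrite eq_sym -subr_eq0 -px; apply/eqP; ring.
pose hp : monic_irreducible_poly p := (ip, mp).
exists {poly %/ p with hp}, (qpolyC p).
by rewrite card_qfpoly sp.
Qed.

Lemma expD_card (F : finFieldType) (K : fieldType) (iota : {rmorphism F -> K})
    (n : nat) (x y : K) :
  (x + y) ^+ (#|F| ^ n) = x ^+ (#|F| ^ n) + y ^+ (#|F| ^ n).
Proof.
have [p p_pr pF] := finPcharP F.
have pK : p \in [pchar K] by rewrite (fmorph_pchar iota).
apply: exprDn_pchar; rewrite pnatX (eq_pnat _ (pcharf_eq pK)).
have := pprimeChar_pgroup pF.
by rewrite /pgroup cardsT => ->.
Qed.

(** The [#|F|] elements of the image of [iota] already exhaust the roots of [X^#|F| - X]. *)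
Lemma fixed_card_in_base (F K : finFieldType) (iota : {rmorphism F -> K}) (z : K) :
  z ^+ #|F| = z -> exists a, iota a = z.
Proof.
move=> zq; have [/codomP[a ->]|zN] := boolP (z \in codom iota); first by exists a.
pose p : {poly K} := 'X^#|F| - 'X.
have sX : (size (- 'X : {poly K})%R < size ('X^#|F| : {poly K})%R)%N.
  by rewrite size_polyN size_polyX size_polyXn ltnS finNzRing_gt1.
have sp : size p = #|F|.+1 by rewrite size_polyDl // size_polyXn.
have p0 : p != 0 by rewrite -size_poly_eq0 sp.
have rootE u : root p u = (u ^+ #|F| == u) by rewrite /root !hornerE subr_eq0.
have := @max_poly_roots _ p (z :: codom iota) p0.
rewrite /= size_codom sp ltnn zN map_inj_uniq ?enum_uniq; last exact: fmorph_inj.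
move=> le_roots; suff : false by []; apply: le_roots => //; rewrite rootE zq eqxx /=.
by apply/allP => _ /codomP[a ->]; rewrite rootE -rmorphXn expf_card.
Qed.

Lemma sum_fibers (I J : finType) (R : nmodType) (g : I -> J) (P : pred J) (h : J -> R) :
  \sum_(i | P (g i)) h (g i) = \sum_(j | P j) h j *+ #|[pred i | g i == j]|.
Proof.
rewrite (partition_big g P) //=; apply: eq_bigr => j Pj.
rewrite -sumr_const; apply: eq_big => [i|i /andP[_ /eqP->]] //=.
by rewrite inE; case: eqP => [->|_]; rewrite ?Pj ?andbF.
Qed.

Lemma sum_card_fibers (I J : finType) (g : I -> J) :
  (\sum_j #|[pred i | g i == j]| = #|I|)%N.
Proof.
rewrite -[RHS]sum1_card (partition_big g xpredT) //=.
by apply: eq_bigr => j _; rewrite -sum1_card; apply: eq_bigl.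
Qed.

Lemma eq_max_of_sum (T : finType) (f : T -> nat) (m : nat) :
  (forall i, (f i <= m)%N) -> (\sum_i f i = #|T| * m)%N -> forall i, f i = m.
Proof.
move=> fm; rewrite -sum_nat_const => /eqP.
have := leqif_sum (fun i (_ : xpredT i) => leqif_eq (fm i)).
by case=> _ -> /forallP H i; apply/eqP/H.
Qed.

(* Only the upper bound 2 needs an argument: equality then follows because the counts
   add up to twice the number of pairs [e]. *)
Lemma quadratic_fibers (F K : finFieldType) (iota : {rmorphism F -> K})
    (Tr Nm : K -> F) :
  #|K| = (#|F| ^ 2)%N ->
  (forall z, iota (Tr z) = z + z ^+ #|F|) ->
  (forall z, iota (Nm z) = z * z ^+ #|F|) ->
  forall e : F * F,
    (#|[pred p : F * F | (p.1 + p.2, p.1 * p.2)%R == e]| +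
     #|[pred z | (Tr z, Nm z) == e]| = 2)%N.
Proof.
move=> cardK hT hN; apply: eq_max_of_sum; last first.
  by rewrite big_split /= !sum_card_fibers cardK !card_prod mulnn muln2 addnn.
case=> e1 e2; have iotaI : injective iota by apply: fmorph_inj.
have zquad z : (Tr z, Nm z) = (e1, e2) -> z ^+ 2 - iota e1 * z + iota e2 = 0.
  by case=> <- <-; rewrite hT hN; ring.
have card_le_seq (T : finType) (A : pred T) (r : seq T) :
    (forall x, A x -> x \in r) -> (#|A| <= size r)%N.
  by move=> Ar; apply: leq_trans (card_size r); apply/subset_leq_card/fintype.subsetP.
(* If [T^2 - e1 T + e2] has roots [x0], [y0] in [F], the pairs are the orderings of these roots, and
   a [z] in the other fiber is fixed by Frobenius, which forces [x0 = y0]. Otherwise there are no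
   pairs, and [z] is one of at most two roots in [K]. *)
have [/existsP[x0 /eqP x0E]|/existsPn noroot] := boolP [exists x, x * (e1 - x) == e2].
  set y0 := e1 - x0 in x0E.
  have iotaq a : iota a ^+ #|F| = iota a by rewrite -rmorphXn /= expf_card.
  have pairs p : (p.1 + p.2, p.1 * p.2) = (e1, e2) -> p \in [:: (x0, y0); (y0, x0)].
    case: p => x y /= [xy1 xy2].
    have yE : y = e1 - x by rewrite -xy1 addrC addKr.
    have /eqP : (x - x0) * (x - y0) = 0.
      transitivity (x0 * y0 - x * (e1 - x)); first by rewrite /y0; ring.
      by rewrite x0E -yE xy2 subrr.
    rewrite mulf_eq0 !subr_eq0 !inE !xpair_eqE yE => /orP[]/eqP ->.
      by rewrite /y0 !eqxx.
    by rewrite /y0 subKr !eqxx orbT.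
  have single z : (Tr z, Nm z) = (e1, e2) -> z = iota x0 /\ x0 = y0.
    move=> zE; have [zT _] := zE.
    have /eqP : (z - iota x0) * (z - iota y0) = 0.
      by rewrite -(zquad z zE) -x0E rmorphM /y0 rmorphB; ring.
    have fixed x : z = iota x -> e1 = x + x.
      by move=> zx; apply: iotaI; rewrite -zT hT zx iotaq rmorphD.
    rewrite mulf_eq0 !subr_eq0 => /orP[]/eqP zx; have e1E := fixed _ zx.
      by split=> //; rewrite /y0 e1E addrK.
    suff x0y0 : x0 = y0 by rewrite zx -x0y0.
    by apply: (addIr y0); rewrite -e1E /y0 addrC subrK.
  have [x0y0|x0y0] := eqVneq x0 y0.
    apply: (leq_add (n1 := 1) (n2 := 1)).
      apply: (card_le_seq _ _ [:: (x0, y0)]) => p /eqP/pairs.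
      by rewrite -x0y0 !inE orbb.
    apply: (card_le_seq _ _ [:: iota x0]) => z /eqP/single[-> _].
    by rewrite mem_head.
  rewrite [X in (_ + X)%N]eq_card0 ?addn0 => [|z]; last first.
    by rewrite !inE; apply: contra_neqF x0y0 => /eqP/single[].
  by apply: (card_le_seq _ _ [:: (x0, y0); (y0, x0)]) => p /eqP/pairs.
rewrite [X in (X + _)%N]eq_card0 => [|[x y]]; last first.
  rewrite !inE /=; apply: contraNF (noroot x) => /eqP[<- <-].
  by rewrite [x + y]addrC addrK.
pose p : {poly K} := 'X^2 - (iota e1) *: 'X + (iota e2)%:P.
have sp : size p = 3.
  rewrite /p -addrA size_polyDl size_polyXn // ltnS.
  rewrite (leq_trans (size_polyD _ _)) // geq_max size_polyN.
  rewrite (leq_trans (size_scale_leq _ _)) ?size_polyX //.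
  by rewrite (leq_trans (size_polyC_leq1 _)).
rewrite add0n cardE; set rs := enum _.
suff : (size rs < size p)%N by rewrite sp.
apply: max_poly_roots.
- by rewrite -size_poly_eq0 sp.
- apply/allP => z; rewrite mem_enum inE => /eqP zE.
  by rewrite /root !hornerE; apply/eqP; rewrite -[RHS](zquad z zE).
- exact: enum_uniq.
Qed.

Definition kloosterman (F : finFieldType) (psi : F -> algC) (c : F) : algC :=
  \sum_(x | x != 0) psi (x + c / x).

(** Both terms on the left sum the same function [h], at the sum and product of two elements of [F]
    and at the trace and norm of one element of [K]. By [quadratic_fibers] each point [(e1, e2)] is
    met twice in all, and summing over [e1] first leaves only [e2 = - c]. *)
Lemma kloosterman_quadratic_ext (F : finFieldType) (psi : F -> algC) (c : F) :
  is_addchar psi -> (exists y, psi y != 1) -> c != 0 ->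
  exists (K : finFieldType) (iota : {rmorphism F -> K}) (psiK : K -> algC),
  [/\ #|K| = (#|F| ^ 2)%N,
      is_addchar psiK /\ (exists y, psiK y != 1),
      forall z, exists2 a, iota a = z + z ^+ #|F| & psiK z = psi a
    & kloosterman psi c ^+ 2 + kloosterman psiK (iota c) = 2 * #|F|%:R].
Proof.
move=> hpsi psi_nontriv c0.
have [K [iota cardK]] := exists_quadratic_extension F.
have iotaI : injective iota by apply: fmorph_inj.
have frobD (x y : K) : (x + y) ^+ #|F| = x ^+ #|F| + y ^+ #|F|.
  by have := expD_card iota 1 x y; rewrite expn1.
have frob2 (x : K) : x ^+ #|F| ^+ #|F| = x by rewrite -exprM mulnn -cardK expf_card.
have [Tr hTr] : exists Tr : K -> F, forall z, iota (Tr z) = z + z ^+ #|F|.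
  apply: (fin_all_exists (P := fun z a => iota a = z + z ^+ #|F|)) => z.
  apply: fixed_card_in_base.
  by rewrite frobD frob2 addrC.
have [Nm hNm] : exists Nm : K -> F, forall z, iota (Nm z) = z * z ^+ #|F|.
  apply: (fin_all_exists (P := fun z a => iota a = z * z ^+ #|F|)) => z.
  apply: fixed_card_in_base.
  by rewrite exprMn frob2 mulrC.
have fibers := quadratic_fibers cardK hTr hNm.
have Tr0 : Tr 0 = 0.
  by apply: iotaI; rewrite hTr rmorph0 expr0n gtn_eqF ?addr0 // (ltnW (finNzRing_gt1 F)).
have TrD : {morph Tr : x y / x + y}.
  by move=> x y; apply: iotaI; rewrite rmorphD !hTr frobD addrACA.
have Nm_eq0 z : (Nm z == 0) = (z == 0).
  by rewrite -(fmorph_eq0 iota) hNm mulf_eq0 expf_eq0 (ltnW (finNzRing_gt1 F)) orbb.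
exists K, iota, (psi \o Tr); split=> //.
- split; first exact: addchar_comp.
  have [y y1] := psi_nontriv.
  have y0 : y != 0 by apply: contraNneq y1 => ->; have [-> _ _] := hpsi.
  (* Since [T^2 - y T + a] has no root in [F], its fiber lies entirely in [K], which provides an
     element of trace [y]. *)
  have [a noroot] := exists_rootless_quadratic y0.
  have := fibers (y, a); rewrite eq_card0 => [|p]; last first.
    rewrite inE; apply: contraNF (noroot p.1) => /eqP[<- <-].
    by rewrite [p.1 + p.2]addrC addrK.
  rewrite add0n => /eqP.
  case: (pickP [pred z | (Tr z, Nm z) == (y, a)]) => [z /eqP[zy _] _|e0].
    by exists z => /=; rewrite zy.
  by rewrite eq_card0.
- by move=> z; exists (Tr z).
(* This form comes from [c / x + c / y = c * (x + y) / (x * y)]. *)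
pose h (e : F * F) := psi (e.1 + c * e.1 / e.2).
have -> : kloosterman psi c ^+ 2 = \sum_(p : F * F | p.1 * p.2 != 0) h (p.1 + p.2, p.1 * p.2).
  rewrite expr2 /kloosterman mulr_suml.
  under eq_bigr do rewrite mulr_sumr.
  rewrite pair_big /=; apply: eq_big => [p|p /andP[x0 y0]]; first by rewrite mulf_eq0 negb_or.
  by have [_ psiD _] := hpsi; rewrite -psiD /h /=; congr psi; field; rewrite x0 y0 .
have -> : kloosterman (psi \o Tr) (iota c) = \sum_(z | Nm z != 0) h (Tr z, Nm z).
  apply: eq_big => [z|z z0]; first by rewrite Nm_eq0.
  congr psi => /=; apply: iotaI.
  have zq0 : z ^+ #|F| != 0 by rewrite expf_neq0.
  have qc : iota c ^+ #|F| = iota c by rewrite -rmorphXn /= expf_card.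
  rewrite hTr rmorphD !rmorphM fmorphV hTr hNm frobD exprMn exprVn qc.
  by move: (z ^+ #|F|) zq0 => u u0; field; rewrite z0 u0.
rewrite (@sum_fibers _ _ _ (fun p : F * F => (p.1 + p.2, p.1 * p.2)) (fun e => e.2 != 0)).
rewrite (@sum_fibers _ _ _ (fun z => (Tr z, Nm z)) (fun e => e.2 != 0)) -big_split /=.
under eq_bigr do rewrite -mulrnDr fibers.
rewrite sumrMnl [RHS]mulr_natl; congr (_ *+ 2).
transitivity (\sum_(e2 | e2 != 0) \sum_e1 psi ((1 + c / e2) * e1)).
  rewrite exchange_big pair_big /=; apply: eq_big => [[e1 e2]|[e1 e2] e20] //=.
  by congr psi => /=; field.
rewrite (bigD1 (- c)) ?oppr_eq0 //= addchar_sum_scaled // invrN mulrN mulfV // subrr eqxx.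
rewrite big1 ?addr0 // => e2 /andP[e20 e2c]; rewrite addchar_sum_scaled //.
case: eqP => // /(congr1 ( *%R^~ e2)); rewrite mul0r mulrDl mul1r divfK // => /eqP.
by rewrite addr_eq0 (negPf e2c).
Qed.

(** The trace splits as [u + u ^ B] with [B = q ^ s] and [u] the sum over [l < s]. The pole of [u]
    at 0 has order [b = q ^ s.-1], so [w = x^b * u] is a polynomial of degree [2 * b] and
    [stepanov_count] applies. *)
Lemma kloosterman_fiber_le (F K : finFieldType) (iota : {rmorphism F -> K})
    (s : nat) (c a : K) (q := #|F|) :
  (0 < s)%N -> #|K| = (q ^ (s + s))%N -> c ^+ q = c ->
  (#|[pred x : K | (x != 0%R) && (a == \sum_(l < s + s) (x + c / x) ^+ (q ^ l))%R]|
    <= q ^ (s + s).-1 + 5 * q ^ s)%N.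
Proof.
move=> s_gt0 cardK cq.
have q_gt1 : (1 < q)%N by exact: finNzRing_gt1.
pose b := (q ^ s.-1)%N; pose B := (q ^ s)%N.
have b_gt0 : (0 < b)%N by rewrite expn_gt0 ltnW.
have BE : (b * q = B)%N by rewrite /B -[in RHS](prednK s_gt0) expnSr.
have frobD l (x y : K) : (x + y) ^+ (q ^ l) = x ^+ (q ^ l) + y ^+ (q ^ l).
  exact: (expD_card iota).
have frob_sum (h : 'I_s -> K) l : (\sum_i h i) ^+ (q ^ l) = \sum_i h i ^+ (q ^ l).
  apply: (big_morph (fun x : K => x ^+ (q ^ l)) (frobD l)).
  by rewrite expr0n gtn_eqF // expn_gt0 ltnW.
have cql l : c ^+ (q ^ l) = c.
  by elim: l => // l IHl; rewrite expnS exprM cq.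
pose w : {poly K} := \sum_(l < s) ('X^(b + q ^ l) + c *: 'X^(b - q ^ l)).
have sw : size w = (b + b).+1.
  rewrite /w -(prednK s_gt0) big_ord_recr /= addrC -addrA.
  rewrite size_polyDl size_polyXn // ltnS.
  apply: (leq_trans (size_polyD _ _)); rewrite geq_max; apply/andP; split.
    apply: (leq_trans (size_scale_leq _ _)); rewrite size_polyXn subnn.
    by rewrite addn_gt0 b_gt0.
  apply: (leq_trans (size_sum _ _ _)); apply/bigmax_leqP => l _.
  have ltlb : (q ^ l < b)%N by rewrite ltn_exp2l.
  apply: (leq_trans (size_polyD _ _)); rewrite geq_max size_polyXn ltn_add2l ltlb /=.
  apply: (leq_trans (size_scale_leq _ _)); rewrite size_polyXn.
  by rewrite (leq_ltn_trans (leq_subr _ _)) // -[X in (X < _)%N]addn0 ltn_add2l.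
have -> : (q ^ (s + s).-1 + 5 * q ^ s = b * (b * q) + 5 * (b * q))%N.
  by rewrite BE /b /B -expnD; congr (q ^ _ + _)%N; lia.
apply: leq_trans (stepanov_count (K := K) (w := w) a b_gt0 q_gt1 _ _ sw); last 2 first.
- by rewrite BE -expnD.
- by move=> x y /=; rewrite BE frobD.
apply/subset_leq_card/fintype.subsetP => x; rewrite !inE => /andP[x0 /eqP aE].
rewrite x0 /= BE; pose u := \sum_(l < s) (x + c / x) ^+ (q ^ l).
have wE : w.[x] = x ^+ b * u.
  rewrite /w /u horner_sum mulr_sumr; apply: eq_bigr => l _.
  rewrite hornerD hornerZ !hornerXn frobD exprMn exprVn cql mulrDr -exprD.
  rewrite mulrCA -expfB_cond //.
  by rewrite (negPf x0) leq_exp2l // -ltnS prednK.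
have auE : a = u + u ^+ B.
  rewrite aE big_split_ord /= frob_sum; congr (_ + _); apply: eq_bigr => l _.
  by rewrite -exprM -expnD addnC.
rewrite wE auE exprMn; apply/eqP; move: (u ^+ B) => v.
have -> : x ^+ b ^+ B = x ^+ (b * B.-1) * x ^+ b.
  rewrite -exprM -exprD; congr (x ^+ _).
  by rewrite -mulnSr prednK // expn_gt0 ltnW.
by ring.
Qed.

(** An upper bound [M] on the fibers [n a] of the trace is enough: as [psi] sums to 0, the sum
    equals minus that of [psi a] with the nonnegative weights [M - n a], whose total is
    [q * M - (#|K| - 1)]. *)
Lemma kloosterman_stepanov (F K : finFieldType) (iota : {rmorphism F -> K})
    (s : nat) (c : F) (psi : F -> algC) (psiK : K -> algC) :
  (0 < s)%N -> #|K| = (#|F| ^ (s + s))%N ->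
  is_addchar psi -> (exists y, psi y != 1) ->
  (forall z, exists2 a, iota a = \sum_(l < s + s) z ^+ (#|F| ^ l) & psiK z = psi a) ->
  `|kloosterman psiK (iota c)| <= (5 * #|F| ^ s.+1 + 1)%:R.
Proof.
move=> s_gt0 cardK hpsi [y0 y01] tr; set q := #|F|.
have q_gt1 : (1 < q)%N by exact: finNzRing_gt1.
have [T hT] : exists T : K -> F, forall z,
    iota (T z) = \sum_(l < s + s) z ^+ (q ^ l) /\ psiK z = psi (T z).
  apply: (fin_all_exists (P := fun z a =>
    iota a = \sum_(l < s + s) z ^+ (q ^ l) /\ psiK z = psi a)) => z.
  by have [a] := tr z; exists a.
pose n a := #|[pred x : K | (x != 0) && (T (x + iota c / x) == a)]|.
pose M := (q ^ (s + s).-1 + 5 * q ^ s)%N.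
have nM a : (n a <= M)%N.
  have cq : iota c ^+ q = iota c by rewrite -rmorphXn /= expf_card.
  apply: leq_trans (kloosterman_fiber_le iota (iota a) s_gt0 cardK cq).
  apply/subset_leq_card/fintype.subsetP => x; rewrite !inE => /andP[-> /eqP<-] /=.
  by have [-> _] := hT (x + iota c / x).
have klE : kloosterman psiK (iota c) = \sum_a psi a *+ n a.
  rewrite /kloosterman (partition_big (fun x => T (x + iota c / x)) predT) //=.
  apply: eq_bigr => a _; rewrite /n -sumr_const; apply: eq_big => [x|x /andP[_ /eqP<-]] //=.
  by have [_ ->] := hT (x + iota c / x).
have sum_n : (\sum_a n a = (#|K|).-1)%N.
  rewrite -(cardC1 0) -sum1_card (partition_big (fun x => T (x + iota c / x)) predT) //=.
  by apply: eq_bigr => a _; rewrite sum1_card; apply: eq_card => x; rewrite !inE.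
have psi_sum0 : \sum_a psi a = 0 := addchar_sum_nontrivial hpsi y01.
have -> : kloosterman psiK (iota c) = - \sum_a psi a *+ (M - n a).
  apply/eqP; rewrite -addr_eq0 klE -big_split /=.
  under eq_bigr do rewrite -mulrnDr subnKC //.
  by rewrite sumrMnl psi_sum0 mul0rn.
rewrite normrN; apply: (le_trans (ler_norm_sum _ _ _)).
have [_ _ psi_norm] := hpsi.
under eq_bigr do rewrite normrMn psi_norm.
rewrite -natr_sum ler_nat sumnB // sum_n sum_nat_const cardK -/q.
have qM : (q * M = q ^ (s + s) + 5 * q ^ s.+1)%N.
  by rewrite /M mulnDr -expnS prednK ?addn_gt0 ?s_gt0 // mulnCA -expnS.
have : (0 < q ^ (s + s))%N by rewrite expn_gt0 ltnW.
by rewrite -/M qM; lia.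
Qed.

(** Here [b ^+ (2 ^ t)] is the square root of [#|K|]. Each quadratic extension turns a ratio [r]
    into at least [r^2 - 2], and [(3 * n)^2 - 2 >= 6 * n] for [n >= 1], so the ratio at least
    doubles. *)
Lemma kloosterman_tower (F : finFieldType) (psi : F -> algC) (c : F) (b : algC) (t : nat) :
  is_addchar psi -> (exists y, psi y != 1) -> c != 0 ->
  0 <= b -> b ^+ 2 = #|F|%:R -> 3 * b <= `|kloosterman psi c| ->
  exists (K : finFieldType) (iota : {rmorphism F -> K}) (psiK : K -> algC),
  [/\ #|K| = (#|F| ^ (2 ^ t))%N,
      is_addchar psiK /\ (exists y, psiK y != 1),
      forall z, exists2 a, iota a = \sum_(l < 2 ^ t) z ^+ (#|F| ^ l) & psiK z = psi a
    & (3 * 2 ^ t)%:R * b ^+ (2 ^ t) <= `|kloosterman psiK (iota c)| ].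
Proof.
move=> hpsi psi_nontriv c0 b0 b2 kl_big.
elim: t => [|t [K [iota [psiK [cardK [hpsiK nontrivK] trK klK]]]]].
  exists F, idfun, psi; rewrite expn0 muln1 expr1; split=> // z.
  by exists z; rewrite // big_ord1 expn0 expr1.
have ic0 : iota c != 0 by rewrite fmorph_eq0.
have [K' [iota' [psi' [cardK' hpsi' trK' klK']]]] :=
  kloosterman_quadratic_ext hpsiK nontrivK ic0.
exists K', (iota' \o iota), psi'; split=> //.
- by rewrite cardK' cardK -expnM expnSr.
- move=> z; have [a aE psia] := trK' z; have [a0 a0E psia0] := trK a.
  exists a0; last by rewrite psia.
  rewrite /= a0E rmorph_sum /= expnS mul2n -addnn big_split_ord /= -big_split /=.
  apply: eq_bigr => l _; rewrite rmorphXn /= aE (expD_card (iota' \o iota)).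
  by rewrite cardK -exprM -expnD.
set B := b ^+ (2 ^ t) in klK; set k := kloosterman psiK _ in klK klK'.
have B0 : 0 <= B by apply: exprn_ge0.
have cardB : #|K|%:R = B ^+ 2 by rewrite cardK natrX -b2 -!exprM mulnC.
have -> : b ^+ (2 ^ t.+1) = B ^+ 2 by rewrite -exprM -expnSr.
have -> : kloosterman psi' ((iota' \o iota) c) = 2 * B ^+ 2 - k ^+ 2.
  by rewrite -cardB -klK' addrC addKr.
have le_k2 : `|k| ^+ 2 <= 2 * B ^+ 2 + `|2 * B ^+ 2 - k ^+ 2|.
  have B2 : 0 <= 2 * B ^+ 2 by rewrite mulr_ge0 ?exprn_ge0 ?ler0n.
  rewrite -normrX -[in X in _ <= X + _](ger0_norm B2).
  by apply: le_trans (ler_normB _ _); rewrite subKr.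
rewrite -(lerD2l (2 * B ^+ 2)); apply: le_trans le_k2.
have n0 : 0 <= (3 * 2 ^ t)%:R * B by rewrite mulr_ge0 ?ler0n.
apply: le_trans (lerXn2r 2 _ _ klK); rewrite ?nnegrE //.
rewrite exprMn -natrX -mulrDl ler_wpM2r ?exprn_ge0 // -natrD ler_nat expnS.
have : (0 < 2 ^ t)%N by rewrite expn_gt0.
by move: (2 ^ t)%N => n; nia.
Qed.

Lemma kloosterman_bound (F : finFieldType) (psi : F -> algC) (c : F) :
  is_addchar psi -> (exists y, psi y != 1) -> c != 0 ->
  `|kloosterman psi c| <= 3 * sqrtC #|F|%:R.
Proof.
move=> hpsi psi_nontriv c0; set b := sqrtC _.
have b0 : 0 <= b by rewrite sqrtC_ge0 ler0n.
have b2 : b ^+ 2 = #|F|%:R by rewrite sqrtCK.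
rewrite real_leNgt ?normr_real ?ger0_real ?mulr_ge0 ?ler0n //; apply/negP => /ltW kl_big.
(* With [2 ^ t = 2 * s], the two bounds give [6 * s * #|F| ^ s <= 5 * #|F| ^ s.+1 + 1]; this choice
   of [t] makes [s > #|F|], a contradiction. *)
pose t := (2 * #|F|)%N.
have q_gt1 : (1 < #|F|)%N by exact: finNzRing_gt1.
have t0 : (0 < t)%N by rewrite muln_gt0 /= ltnW.
have [K [iota [psiK [cardK _ trK le_kl]]]] :=
  kloosterman_tower t hpsi psi_nontriv c0 b0 b2 kl_big.
pose s := (2 ^ t.-1)%N.
have ssE : (2 ^ t = s + s)%N by rewrite addnn -mul2n -expnS prednK.
rewrite ssE in cardK trK le_kl.
have s0 : (0 < s)%N by rewrite expn_gt0.
have := le_trans le_kl (kloosterman_stepanov c s0 cardK hpsi psi_nontriv trK).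
rewrite addnn -mul2n exprM b2 -natrX -natrM ler_nat expnS.
have lt_ts : (t < 2 * s)%N by rewrite mul2n -addnn -ssE ltn_expl.
have Q0 : (0 < #|F| ^ s)%N by rewrite expn_gt0 ltnW.
by move: (#|F| ^ s)%N Q0 => Q Q0; rewrite /t in lt_ts *; nia.
Qed.

(** * Gauss and Salie sums *)

(** Weyl differencing: once the second variable is written [x + y], the sum over [x] is that of the
    character [beta^~ y], which vanishes unless this character is trivial. *)
Lemma normsq_quadratic_sum (V : finZmodType) (theta : V -> algC) (beta : V -> V -> algC) :
  (forall x, `|theta x| = 1) ->
  (forall x y, theta (x + y) = theta x * theta y * beta x y) ->
  (forall y, is_addchar (beta^~ y)) ->
  `|\sum_x theta x| ^+ 2 = #|V|%:R * \sum_(y | [forall x, beta x y == 1]) theta y.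
Proof.
move=> th1 thD hbeta.
rewrite normCK rmorph_sum mulr_sumr.
transitivity (\sum_x \sum_y theta y * beta x y).
  apply: eq_bigr => x _; rewrite mulr_suml (reindex_inj (addrI x)) /=.
  apply: eq_bigr => y _; rewrite thD.
  have e : theta x * (theta x)^* = 1 by rewrite -normCK th1 expr1n.
  by rewrite -[RHS]mul1r -e; ring.
rewrite exchange_big /= mulr_sumr [RHS]big_mkcond /=; apply: eq_bigr => y _.
rewrite -mulr_sumr; case: ifPn => [/forallP b1|/forallPn[x bx]].
  under eq_bigr do rewrite (eqP (b1 _)).
  by rewrite sumr_const mulrC.
by rewrite (addchar_sum_nontrivial (hbeta y) bx) mulr0.
Qed.

Lemma square_fiber_le2 (F : finFieldType) (a z : F) :
  a != 0 -> (#|[pred y : F | (a * y ^+ 2)%R == z]| <= 2)%N.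
Proof.
move=> a0; case: (pickP [pred y : F | a * y ^+ 2 == z]) => [y0 /eqP y0z|e0]; last first.
  by rewrite eq_card0.
apply: leq_trans (card_size [:: y0; - y0]); apply/subset_leq_card/fintype.subsetP => y.
rewrite !inE -y0z => /eqP/(mulfI a0)/eqP; rewrite -subr_eq0 subr_sqr mulf_eq0.
by rewrite subr_eq0 addr_eq0.
Qed.

(** The squares and their multiples by [g] meet only at 0, so each total is at most 2; the totals
    add up to [2 * #|F|], which forces equality. *)
Lemma nonsquare_fibers (F : finFieldType) (g : F) :
  (forall u, u ^+ 2 != g) -> forall z,
  (#|[pred y : F | (y ^+ 2)%R == z]| + #|[pred y : F | (g * y ^+ 2)%R == z]| = 2)%N.
Proof.
move=> gN; have g0 : g != 0 by apply: contraNneq (gN 0) => ->; rewrite expr0n.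
apply: eq_max_of_sum => [z|]; last first.
  by rewrite big_split /= !sum_card_fibers muln2 addnn.
have [->|z0] := eqVneq z 0.
  apply: (leq_add (n1 := 1) (n2 := 1)); apply: leq_trans (card_size [:: 0]);
    apply/subset_leq_card/fintype.subsetP => y; rewrite !inE.
    by rewrite expf_eq0.
  by rewrite mulf_eq0 (negPf g0) expf_eq0.
case: (pickP [pred y : F | g * y ^+ 2 == z]) => [y0 /eqP y0z|e0]; last first.
  rewrite [X in (_ + X)%N]eq_card0 // addn0.
  have := @square_fiber_le2 F 1 z (oner_neq0 _).
  by congr (_ <= _)%N; apply: eq_card => y; rewrite !inE mul1r.
rewrite [X in (X + _)%N]eq_card0 ?square_fiber_le2 // => y; rewrite inE.
have y00 : y0 != 0 by apply: contraNneq z0 => y00; rewrite -y0z y00 expr0n mulr0.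
apply: contraNF (gN (y / y0)) => /eqP yz.
by rewrite expr_div_n yz -y0z mulfK // expf_neq0.
Qed.

(** In characteristic 2 squaring is injective, hence onto. *)
Lemma nonsquare_pchar (F : finFieldType) (g : F) :
  (forall u, u ^+ 2 != g) -> (2 : F) != 0.
Proof.
move=> gN; apply/eqP => two0.
have sq_inj : injective (fun u : F => u ^+ 2).
  move=> u v /= uv; apply/eqP; rewrite -subr_eq0 -sqrf_eq0.
  apply/eqP; transitivity (u ^+ 2 - v ^+ 2 - 2 * v * (u - v)); first by ring.
  by rewrite uv two0 !mul0r !subrr.
have := injF_onto sq_inj g.
by case/codomP => u /eqP; rewrite eq_sym (negPf (gN u)).
Qed.

(** The substitution [x = - t * s] yields the Kloosterman sum at [t * c]. For [c = 0] that sum is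
    the full character sum less its term at 0, namely -1. *)
Lemma linear_twist_kloosterman (F : finFieldType) (psi : F -> algC) (t c : F) :
  is_addchar psi -> (exists y, psi y != 1) -> t != 0 ->
  `|\sum_(s | s != 0) psi (- (s * t) - c / s)| <= 3 * sqrtC #|F|%:R.
Proof.
move=> hpsi psi_nontriv t0.
have -> : \sum_(s | s != 0) psi (- (s * t) - c / s) = kloosterman psi (t * c).
  have nt0 : - t != 0 by rewrite oppr_eq0.
  rewrite /kloosterman [RHS](reindex_inj (mulfI nt0)) /=.
  apply: eq_big => [s|s s0]; first by rewrite mulf_eq0 (negPf nt0).
  by congr psi; field; rewrite s0 ?nt0.
have [->|c0] := eqVneq c 0; last by rewrite kloosterman_bound // mulf_neq0.
have [y0 y01] := psi_nontriv; have [psi0 _ _] := hpsi.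
have -> : kloosterman psi (t * 0) = -1.
  rewrite /kloosterman; under eq_bigr do rewrite mulr0 mul0r addr0.
  apply/eqP; rewrite -addr_eq0 addrC -psi0.
  have /eqP := addchar_sum_nontrivial hpsi y01.
  by rewrite (bigD1 0).
have q1 : 1 <= sqrtC #|F|%:R :> algC.
  rewrite -[X in X <= _]sqrtC1 ler_sqrtC ?qualifE /= ?ler01 ?ler0n // (ler_nat _ 1).
  exact: ltnW (finNzRing_gt1 F).
by rewrite normrN1 (le_trans q1) // ler_peMl ?sqrtC_ge0 ?ler0n // ler1n.
Qed.

Definition gauss_sum (F : finFieldType) (psi : F -> algC) (s : F) : algC :=
  \sum_y psi (s * y ^+ 2).

(** By [nonsquare_fibers] the two Gauss sums add up to twice the sum of [psi (s * z)] over all [z],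
    which is 0. *)
Lemma gauss_sum_nonsquare (F : finFieldType) (psi : F -> algC) (g s : F) :
  is_addchar psi -> (exists y, psi y != 1) -> (forall u, u ^+ 2 != g) -> s != 0 ->
  gauss_sum psi (g * s) = - gauss_sum psi s.
Proof.
move=> hpsi psi_nontriv gN s0; apply/eqP; rewrite -addr_eq0 addrC; apply/eqP.
have -> : gauss_sum psi (g * s) = \sum_(y | predT (g * y ^+ 2)) psi (s * (g * y ^+ 2)).
  by apply: eq_bigr => y _; rewrite -mulrA mulrCA.
rewrite /gauss_sum (@sum_fibers _ _ _ (fun y => y ^+ 2) predT (fun z => psi (s * z))).
rewrite (@sum_fibers _ _ _ (fun y => g * y ^+ 2) predT (fun z => psi (s * z))).
rewrite -big_split /=; under eq_bigr do rewrite -mulrnDr nonsquare_fibers //.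
by rewrite sumrMnl addchar_sum_scaled // (negPf s0) mul0rn.
Qed.

Lemma gauss_sum_squareM (F : finFieldType) (psi : F -> algC) (s u : F) :
  u != 0 -> gauss_sum psi (s * u ^+ 2) = gauss_sum psi s.
Proof.
move=> u0; rewrite /gauss_sum [RHS](reindex_inj (mulfI u0)) /=.
by apply: eq_bigr => y _; congr psi; ring.
Qed.

Lemma gauss_sum_normsq (F : finFieldType) (psi : F -> algC) (s : F) :
  is_addchar psi -> (exists y, psi y != 1) -> (2 : F) != 0 -> s != 0 ->
  `|gauss_sum psi s| ^+ 2 = #|F|%:R.
Proof.
move=> hpsi [z z1] two0 s0; have [psi0 psiD psi_norm] := hpsi.
pose beta x y := psi (s * (2 * x * y)).
have hbeta y : is_addchar (beta^~ y).
  apply: (addchar_comp (h := fun x => s * (2 * x * y))) hpsi => [|x x'].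
    by rewrite mulr0 mul0r mulr0.
  by ring.
rewrite /gauss_sum (normsq_quadratic_sum (beta := beta)) //; last first.
  by move=> x y; rewrite -!psiD; congr psi; ring.
rewrite (big_pred1 0) ?expr0n ?mulr0 ?psi0 ?mulr1 // => y /=.
apply/forallP/eqP => [b1|-> x]; last by rewrite /beta !mulr0 psi0.
apply: contraNeq z1 => y0; have := b1 (z / (s * 2 * y)).
rewrite /beta; congr (psi _ == 1); field.
by rewrite two0 s0 y0.
Qed.

Lemma nonsquare_coset (F : finFieldType) (g z : F) :
  (forall u, u ^+ 2 != g) -> (exists u, z = u ^+ 2) \/ (exists u, z = g * u ^+ 2).
Proof.
move=> gN; have := nonsquare_fibers gN z.
case: (pickP [pred y : F | y ^+ 2 == z]) => [u /eqP uz _|e0]; first by left; exists u.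
case: (pickP [pred y : F | g * y ^+ 2 == z]) => [u /eqP uz _|e1]; first by right; exists u.
by rewrite !eq_card0.
Qed.

(** Shifting [y] by [k / s] in the Gauss sum absorbs [a * k ^ 2 / s]. The sum over [s] then detects
    [a * y ^ 2 = t]: at most two [y] contribute [#|F|] each, and the missing [s = 0] costs at most
    [#|F|]. *)
Lemma salie_bound_coset (F : finFieldType) (psi : F -> algC) (t a k : F) :
  is_addchar psi -> (exists y, psi y != 1) -> a != 0 ->
  `|\sum_(s | s != 0) psi (- (s * t) - a * k ^+ 2 / s) * gauss_sum psi (a * s)|
    <= 3 * #|F|%:R.
Proof.
move=> hpsi psi_nontriv a0; have [psi0 psiD psi_norm] := hpsi.
pose L y := psi (2 * a * k * y).
have -> : \sum_(s | s != 0) psi (- (s * t) - a * k ^+ 2 / s) * gauss_sum psi (a * s) =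
    \sum_(y | a * y ^+ 2 == t) L y *+ #|F| - \sum_y L y.
  transitivity (\sum_(s | s != 0) \sum_y L y * psi ((a * y ^+ 2 - t) * s)).
    apply: eq_bigr => s s0; rewrite /gauss_sum (reindex_inj (addrI (k / s))) /=.
    rewrite mulr_sumr; apply: eq_bigr => y _; rewrite /L -!psiD; congr psi.
    by field; rewrite s0.
  rewrite exchange_big [X in _ = X - _]big_mkcond /= -sumrB; apply: eq_bigr => y _.
  rewrite -mulr_sumr; have := addchar_sum_scaled (a * y ^+ 2 - t) hpsi psi_nontriv.
  rewrite (bigD1 0) //= mulr0 psi0 subr_eq0 => sumE.
  rewrite (_ : \sum_(s | s != 0) _ = (if a * y ^+ 2 == t then #|F|%:R else 0) - 1).
    by case: ifP => _; rewrite mulrBr mulr1 ?mulr_natr ?mulr0.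
  by rewrite -sumE [1 + _]addrC addrK.
apply: le_trans (ler_normB _ _) _.
have le2 : `|\sum_(y | a * y ^+ 2 == t) L y *+ #|F| | <= 2 * #|F|%:R.
  apply: le_trans (ler_norm_sum _ _ _) _.
  under eq_bigr do rewrite normrMn psi_norm.
  rewrite sumr_const -mulrnA -natrM ler_nat mulnC leq_mul2r.
  by rewrite (square_fiber_le2 t a0) orbT.
have le1 : `|\sum_y L y| <= #|F|%:R.
  apply: le_trans (ler_norm_sum _ _ _) _.
  under eq_bigr do rewrite psi_norm.
  by rewrite sumr_const.
have -> : 3 * #|F|%:R = 2 * #|F|%:R + #|F|%:R :> algC by ring.
exact: lerD.
Qed.

(** Every [c] is [a * k ^ 2] with [a] either 1 or [g], and replacing [gauss_sum psi s] by
    [gauss_sum psi (g * s)] only changes a sign. *)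
Lemma salie_bound (F : finFieldType) (psi : F -> algC) (g t c : F) :
  is_addchar psi -> (exists y, psi y != 1) -> (forall u, u ^+ 2 != g) ->
  `|\sum_(s | s != 0) psi (- (s * t) - c / s) * gauss_sum psi s| <= 3 * #|F|%:R.
Proof.
move=> hpsi psi_nontriv gN.
have g0 : g != 0 by apply: contraNneq (gN 0) => ->; rewrite expr0n.
have [[k ->]|[k ->]] := nonsquare_coset c gN.
  have := salie_bound_coset t k hpsi psi_nontriv (oner_neq0 _).
  by under eq_bigr do rewrite !mul1r.
rewrite -normrN -sumrN.
have := salie_bound_coset t k hpsi psi_nontriv g0.
by under eq_bigr do rewrite gauss_sum_nonsquare // mulrN.
Qed.

(* A function constant on square classes is a combination of [1] and of the
   quadratic Gauss sum, so the sum splits into a Kloosterman and a Salie sum. *)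
Lemma square_class_twist_bound (F : finFieldType) (psi : F -> algC) (t c : F)
    (G : F -> algC) (M : algC) :
  is_addchar psi -> (exists y, psi y != 1) -> t != 0 ->
  (forall s u, s != 0 -> u != 0 -> G (s * u ^+ 2) = G s) ->
  (forall s, s != 0 -> `|G s| <= M) ->
  `|\sum_(s | s != 0) psi (- (s * t) - c / s) * G s| <= 6 * (M * sqrtC #|F|%:R).
Proof.
move=> hpsi psi_nontriv t0 Gsq GM; set b := sqrtC _.
have b0 : 0 < b by rewrite sqrtC_gt0 ltr0n ltnW // finNzRing_gt1.
have M0 : 0 <= M by apply: le_trans (GM 1 (oner_neq0 _)).
have Gu s u : s = u ^+ 2 -> s != 0 -> G s = G 1.
  move=> -> s0; rewrite -[u ^+ 2]mul1r Gsq ?oner_neq0 //.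
  by apply: contraNneq s0 => ->; rewrite expr0n.
have klb := linear_twist_kloosterman c hpsi psi_nontriv t0.
have [/existsP[g /existsPn gN]|/existsPn allsq] :=
  boolP [exists g : F, ~~ [exists u, u ^+ 2 == g]]; last first.
  under eq_bigr => s s0.
    have /negPn/existsP[u /eqP us] := allsq s.
    rewrite (Gu s u) //; over.
  rewrite -mulr_suml normrM; apply: le_trans (ler_pM _ _ klb (GM 1 (oner_neq0 _))) _ => //.
  rewrite -/b [3 * b * M](_ : _ = 3 * (M * b)); last by ring.
  by rewrite ler_wpM2r ?mulr_ge0 ?(ltW b0) // ler_nat.
have two0 := nonsquare_pchar gN.
have g0 : g != 0 by apply: contraNneq (gN 0) => ->; rewrite expr0n.
set gam := gauss_sum psi 1.
have gam_norm : `|gam| = b.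
  apply/eqP; rewrite -(@eqrXn2 _ 2) ?normr_ge0 ?ltW //.
  by rewrite gauss_sum_normsq ?oner_neq0 // sqrtCK.
have gam0 : gam != 0 by rewrite -normr_eq0 gam_norm gt_eqF.
(* These solve [A + D * gam = G 1] and [A - D * gam = G g], the values on the two square classes. *)
pose A := (G 1 + G g) / 2; pose D := (G 1 - G g) / 2 / gam.
have GE s : s != 0 -> G s = A + D * gauss_sum psi s.
  move=> s0; have [[u us]|[u us]] := nonsquare_coset s gN.
    have u0 : u != 0 by apply: contraNneq s0 => u0; rewrite us u0 expr0n.
    rewrite (Gu s u) // us -[u ^+ 2]mul1r gauss_sum_squareM // -/gam /D divfK //.
    by rewrite /A; field.
  have u0 : u != 0 by apply: contraNneq s0 => u0; rewrite us u0 expr0n mulr0.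
  rewrite us Gsq // gauss_sum_squareM // -[g in gauss_sum _ g]mulr1.
  rewrite gauss_sum_nonsquare ?oner_neq0 // -/gam mulrN /D divfK //.
  by rewrite /A; field.
have two_norm : `|2 : algC| = 2 by rewrite ger0_norm ?ler0n.
have AM : `|A| <= M.
  rewrite /A normrM normfV two_norm ler_pdivrMr ?ltr0n //.
  by apply: le_trans (ler_normD _ _) _; rewrite mulr_natr mulr2n lerD ?GM ?oner_neq0.
have DM : `|D| * b <= M.
  rewrite /D !normrM !normfV gam_norm divfK ?gt_eqF // two_norm ler_pdivrMr ?ltr0n //.
  by apply: le_trans (ler_normB _ _) _; rewrite mulr_natr mulr2n lerD ?GM ?oner_neq0.
clearbody A D; under eq_bigr => s s0 do rewrite GE // mulrDr mulrCA.
rewrite big_split /= -mulr_suml -mulr_sumr.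
apply: le_trans (ler_normD _ _) _; rewrite !normrM.
have -> : 6 * (M * b) = 3 * b * M + 3 * (b * M) by ring.
apply: lerD; first by apply: ler_pM.
apply: le_trans (ler_wpM2l _ (salie_bound t c hpsi psi_nontriv gN)) _ => //.
rewrite -[#|F|%:R]sqrtCK -/b expr2 mulrCA ler_wpM2l ?ler0n // mulrA [b * M]mulrC.
by rewrite ler_wpM2r // ltW.
Qed.

(** * Fourier transform of a quadric *)

Lemma polarC (F : fieldType) (d : nat) (Q : 'rV[F]_d -> F) x y : polar Q x y = polar Q y x.
Proof. by rewrite /polar [x + y]addrC addrAC. Qed.

Lemma quadratic_formZ (F : fieldType) (d : nat) (Q : 'rV[F]_d -> F) a x :
  is_quadratic_form Q -> Q (a *: x) = a ^+ 2 * Q x.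
Proof.
case=> A QA; rewrite !QA mulr_sumr; apply: eq_bigr => i _.
by rewrite mulr_sumr; apply: eq_bigr => j _; rewrite !mxE; ring.
Qed.

Lemma polarP (F : fieldType) (d : nat) (Q : 'rV[F]_d -> F) a x x' y :
  is_quadratic_form Q -> polar Q (a *: x + x') y = a * polar Q x y + polar Q x' y.
Proof.
case=> A QA.
have polarE u v : polar Q u v =
    \sum_i \sum_j A i j * (u 0 i * v 0 j + v 0 i * u 0 j).
  rewrite /polar !QA -!sumrB; apply: eq_bigr => i _; rewrite -!sumrB.
  by apply: eq_bigr => j _; rewrite !mxE; ring.
rewrite !polarE mulr_sumr -big_split /=; apply: eq_bigr => i _.
rewrite mulr_sumr -big_split /=; apply: eq_bigr => j _.
by rewrite !mxE; ring.
Qed.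

Lemma quadratic_formD (F : fieldType) (d : nat) (Q : 'rV[F]_d -> F) x y :
  Q (x + y) = Q x + Q y + polar Q x y.
Proof. by rewrite /polar; ring. Qed.

Lemma pchar2_sqrt (F : finFieldType) (z : F) : (2 : F) = 0 -> exists u, z = u ^+ 2.
Proof.
move=> two0; have [/existsP[u /eqP <-]|/existsPn zN] := boolP [exists u, u ^+ 2 == z].
  by exists u.
by have := nonsquare_pchar zN; rewrite two0 eqxx.
Qed.

Section QuadraticFourier.

Variables (F : finFieldType) (d : nat) (Q : 'rV[F]_d -> F) (psi : F -> algC).
Hypotheses (hQ : is_quadratic_form Q) (ndQ : nondegenerate_form Q).
Hypotheses (hpsi : is_addchar psi) (psi_nontriv : exists y, psi y != 1).

Let radical y := forall x, polar Q x y = 0.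

Lemma polar0l y : polar Q 0 y = 0.
Proof. by rewrite -[X in polar Q X y](addNr 0) -scaleN1r polarP // mulN1r addNr. Qed.

Lemma polarZ a x y : polar Q (a *: x) y = a * polar Q x y.
Proof. by rewrite -[a *: x]addr0 polarP // polar0l addr0. Qed.

Lemma polar_addchar s y : is_addchar (fun x => psi (s * polar Q x y)).
Proof.
apply: (addchar_comp (h := fun x => s * polar Q x y)) hpsi => [|x x'].
  by rewrite polar0l mulr0.
by rewrite -[x in x + x']scale1r polarP // mul1r mulrDr.
Qed.

Lemma polar_trivialP s y : s != 0 ->
  reflect (radical y) [forall x, psi (s * polar Q x y) == 1].
Proof.
move=> s0; have [psi0 _ _] := hpsi.
apply: (iffP forallP) => [triv x|rad x]; last by rewrite rad mulr0 psi0.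
have [z z1] := psi_nontriv; apply: contraNeq z1 => p0.
have := triv ((z / (s * polar Q x y)) *: x).
rewrite polarZ; congr (psi _ == 1); field.
by rewrite s0 p0.
Qed.

Lemma card_rVE : #|{: 'rV[F]_d}| = (#|F| ^ d)%N.
Proof. by rewrite card_mx mul1n. Qed.

Lemma quadratic_sum_normsq s (l : 'rV[F]_d -> F) :
  l 0 = 0 -> {morph l : x y / x + y} -> s != 0 ->
  `|\sum_w psi (s * Q w + l w)| ^+ 2 =
    (#|F| ^ d)%:R * \sum_(y | [forall x, psi (s * polar Q x y) == 1]) psi (s * Q y + l y).
Proof.
move=> l0 lD s0; have [psi0 psiD psi_norm] := hpsi.
rewrite (normsq_quadratic_sum (beta := fun x y => psi (s * polar Q x y))) ?card_rVE //.
  by move=> x y; rewrite -!psiD quadratic_formD lD; congr psi; ring.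
exact: polar_addchar.
Qed.

Lemma level_indicatorE t w :
  #|F|%:R * (Q w == t)%:R - 1 = \sum_(s | s != 0) psi (s * (Q w - t)) :> algC.
Proof.
have := addchar_sum_scaled (Q w - t) hpsi psi_nontriv.
have [psi0 _ _] := hpsi; rewrite (bigD1 0) //= mulr0 psi0 subr_eq0 => sumE.
transitivity ((if Q w == t then #|F|%:R else 0) - 1 : algC).
  by case: ifP => _; rewrite ?mulr1 ?mulr0.
rewrite -sumE [1 + _]addrC addrK; apply: eq_bigr => s _; by rewrite mulrC.
Qed.

Lemma level_fourierE t (l : 'rV[F]_d -> F) :
  \sum_w (#|F|%:R * (Q w == t)%:R - 1) * psi (l w) =
  \sum_(s | s != 0) psi (- (s * t)) * \sum_w psi (s * Q w + l w).
Proof.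
have [_ psiD _] := hpsi.
under eq_bigr do rewrite level_indicatorE mulr_suml.
rewrite exchange_big /=; apply: eq_bigr => s _; rewrite mulr_sumr.
by apply: eq_bigr => w _; rewrite -!psiD; congr psi; ring.
Qed.

(** Shifting [w] by [s^-1 *: a] completes the square: the frequency [a] survives only in
    [psi (- (Q a / s))]. What remains is a Gauss sum [G s] of modulus [sqrt(q)^d] that depends only
    on the square class of [s], as [square_class_twist_bound] requires. *)
Lemma level_fourier_regular t a :
  (forall y, radical y -> y = 0) -> t != 0 ->
  `|\sum_w (#|F|%:R * (Q w == t)%:R - 1) * psi (polar Q a w)| <=
    6 * sqrtC #|F|%:R ^+ d.+1.
Proof.
move=> rad0 t0; have [psi0 psiD _] := hpsi.
pose G s := \sum_w psi (s * Q w + 0).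
rewrite level_fourierE; under eq_bigr => s s0.
  rewrite [X in _ * X](_ : _ = psi (- (Q a / s)) * G s); last first.
    rewrite /G mulr_sumr [RHS](reindex_inj (addrI (s^-1 *: a))) /=.
    apply: eq_bigr => w _; rewrite -psiD; congr psi.
    by rewrite quadratic_formD quadratic_formZ // polarZ; field; rewrite s0.
  rewrite mulrA -psiD; over.
rewrite /= exprSr; apply: square_class_twist_bound => // s.
  move=> u s0 u0; rewrite /G [RHS](reindex_inj (scalerI u0)) /=.
  by apply: eq_bigr => w _; rewrite quadratic_formZ //; congr psi; ring.
move=> s0; have q0 : 0 <= sqrtC #|F|%:R :> algC by rewrite sqrtC_ge0 ler0n.
rewrite -(@ler_pXn2r _ 2) ?nnegrE ?exprn_ge0 //.
rewrite (quadratic_sum_normsq (l := fun=> 0)) // => [|x y]; last by rewrite addr0.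
rewrite (big_pred1 0) => [|y /=]; last first.
  apply/(polar_trivialP _ s0)/eqP => [/rad0 //|-> x].
  by rewrite polarC polar0l.
rewrite -[X in Q X](scale0r 0) quadratic_formZ // expr0n mul0r mulr0 addr0 psi0 mulr1.
by rewrite exprAC sqrtCK natrX.
Qed.

(* The radical is then the line spanned by [z] in characteristic 2, where
   [u |-> s * Q z * u ^+ 2 + l z * u] is additive. The square of the Gauss sum of
   parameter [s] vanishes unless the resulting character is trivial, which
   happens for at most one [s]. *)
Lemma level_fourier_singular t z (l : 'rV[F]_d -> F) :
  radical z -> z != 0 -> l 0 = 0 -> {morph l : x y / x + y} ->
  (forall a x, l (a *: x) = a * l x) ->
  `|\sum_w (#|F|%:R * (Q w == t)%:R - 1) * psi (l w)| <= sqrtC #|F|%:R ^+ d.+1.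
Proof.
move=> radz z0 l0 lD lZ; have [psi0 psiD psi_norm] := hpsi.
have Qz0 : Q z != 0.
  by apply: contraNneq z0 => Qz; apply/eqP; apply: ndQ => // y; rewrite polarC.
have two0 : (2 : F) = 0.
  apply/eqP; have := radz z; rewrite /polar -mulr2n -scaler_nat quadratic_formZ // => /eqP.
  rewrite (_ : _ - _ - _ = 2 * Q z); last by ring.
  by rewrite mulf_eq0 (negPf Qz0) orbF.
have radP y : radical y <-> exists u, y = u *: z.
  split=> [rady|[u ->] x]; last first.
    by rewrite polarC polarZ polarC radz mulr0.
  (* This [u] gives [Q (y - u *: z) = 2 * Q y = 0], so nondegeneracy kills the radical vector
     [y - u *: z]. *)
  have [u uE] := pchar2_sqrt (Q y / Q z) two0; exists u.
  apply/eqP; rewrite -subr_eq0 -scaleNr addrC; apply/eqP; apply: ndQ => [x|].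
    by rewrite polarP // !(polarC _ _ x) radz mulr0 add0r rady.
  rewrite quadratic_formD quadratic_formZ // sqrrN -uE divfK // polarZ polarC radz.
  rewrite mulr0 addr0; transitivity (2 * Q y); first by ring.
  by rewrite two0 mul0r.
pose S s := \sum_w psi (s * Q w + l w).
pose h s u := psi (s * Q z * u ^+ 2 + l z * u).
have hchar s : is_addchar (h s).
  apply: (addchar_comp (h := fun u => s * Q z * u ^+ 2 + l z * u)) hpsi => [|u v].
    by rewrite expr0n !mulr0 addr0.
  transitivity (s * Q z * u ^+ 2 + l z * u + (s * Q z * v ^+ 2 + l z * v) +
    2 * (s * Q z * u * v)); first by ring.
  by rewrite two0 mul0r addr0.
have SE s : s != 0 -> `|S s| ^+ 2 = (#|F| ^ d)%:R * \sum_u h s u.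
  move=> s0; rewrite quadratic_sum_normsq //; congr (_ * _).
  rewrite (reindex_omap (fun u => u *: z) (fun y => [pick u | y == u *: z])) /=; last first.
    move=> y /(polar_trivialP _ s0)/radP[u yE]; case: pickP => [v /eqP-> //|/(_ u)].
    by rewrite yE eqxx.
  apply: eq_big => [u|u _]; last by rewrite /h quadratic_formZ // lZ; congr psi; ring.
  apply/andP; split; first by apply/(polar_trivialP _ s0)/radP; exists u.
  case: pickP => [v /eqP/eqP|/(_ u)]; last by rewrite eqxx.
  rewrite -subr_eq0 -scalerBl scaler_eq0 (negPf z0) orbF subr_eq0 => /eqP ->.
  by rewrite eqxx.
have S_triv s : s != 0 -> S s != 0 -> forall u, h s u = 1.
  move=> s0 Ss0 u; apply: contraNeq Ss0 => hu.
  by rewrite -normr_eq0 -sqrf_eq0 SE // (addchar_sum_nontrivial (hchar s) hu) mulr0.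
have q0 : 0 <= sqrtC #|F|%:R :> algC by rewrite sqrtC_ge0 ler0n.
rewrite level_fourierE -/S.
case: (pickP [pred s | (s != 0) && (S s != 0)]) => [s0|S0]; last first.
  rewrite big1 ?normr0 ?exprn_ge0 // => s sn0; have := S0 s.
  by rewrite /= sn0 /= => /negbFE/eqP; rewrite -/(S s) => ->; rewrite mulr0.
move=> /andP[s0n0 Ss0]; rewrite (bigD1 s0) //= [X in _ + X]big1 ?addr0 => [|s /andP[sn0 s_s0]].
  rewrite normrM psi_norm mul1r -(@ler_pXn2r _ 2) ?nnegrE ?exprn_ge0 //.
  rewrite SE //; under eq_bigr do rewrite S_triv //.
  by rewrite sumr_const exprAC sqrtCK natrX exprSr.
apply/eqP; rewrite mulf_eq0; apply/orP; right; apply: contraT => Ss.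
(* A second surviving parameter [s] would give [psi ((s - s0) * Q z * u ^+ 2) = 1] for every [u],
   whereas the argument of [psi] takes every value of [F]. *)
have [y y1] := psi_nontriv; have d0 : (s - s0) * Q z != 0 by rewrite mulf_neq0 // subr_eq0.
have [u uE] := pchar2_sqrt (y / ((s - s0) * Q z)) two0.
have := S_triv s sn0 Ss u; have := S_triv s0 s0n0 Ss0 u; rewrite /h => h0 h1.
have := psiD (s * Q z * u ^+ 2 + l z * u) (- (s0 * Q z * u ^+ 2 + l z * u)).
rewrite h1 addcharN // h0 conjC1 mulr1 => /eqP.
rewrite (_ : _ - _ = (s - s0) * Q z * u ^+ 2); last by ring.
by rewrite -uE mulrC divfK // (negPf y1).
Qed.

(** The characters of [F^d] are indexed through a nondegenerate symmetric pairing: the polar form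
    when its radical is 0, so that the square can be completed, and the dot product otherwise. *)
Lemma level_fourier_bound t : t != 0 ->
  exists e : 'rV[F]_d -> 'rV[F]_d -> algC,
  [/\ forall a, is_addchar (e a),
      forall w, \sum_a e a w = if w == 0 then (#|F| ^ d)%:R else 0
    & forall a, `|\sum_w (#|F|%:R * (Q w == t)%:R - 1) * e a w| <=
        6 * sqrtC #|F|%:R ^+ d.+1 ].
Proof.
move=> t0; have [psi0 psiD psi_norm] := hpsi.
have orth (p : 'rV[F]_d -> 'rV[F]_d -> F) :
    (forall x y, p x y = p y x) -> (forall a x x' y, p (a *: x + x') y = a * p x y + p x' y) ->
    (forall w, w != 0 -> exists a, p a w != 0) ->
    (forall a, is_addchar (fun w => psi (p a w))) /\
    (forall w, \sum_a psi (p a w) = if w == 0 then (#|F| ^ d)%:R else 0).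
  move=> pC pP pnd.
  have p0 y : p 0 y = 0.
    by rewrite -[X in p X y](addNr 0) -scaleN1r pP mulN1r addNr.
  have pD w x x' : p (x + x') w = p x w + p x' w.
    by rewrite -[x in LHS]scale1r pP mul1r.
  split=> [a|w].
    by apply: (addchar_comp (h := p a)) hpsi => [|x x']; rewrite !(pC a) ?p0.
  have pchar : is_addchar (fun a => psi (p a w)).
    by apply: (addchar_comp (h := p^~ w)) hpsi => // x x'; apply: pD.
  case: eqP => [->|/eqP w0].
    under eq_bigr do rewrite pC p0 psi0.
    by rewrite sumr_const card_rVE.
  have [a aw] := pnd w w0; have [y y1] := psi_nontriv.
  apply: (addchar_sum_nontrivial (y := (y / p a w) *: a + 0) pchar).
  by rewrite pP p0 addr0 divfK.
have [/existsP[z /andP[z0 /(polar_trivialP _ (oner_neq0 _)) radz]]|/existsPn nrad] :=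
    boolP [exists z, (z != 0) && [forall x, psi (1 * polar Q x z) == 1]].
  pose dot (x y : 'rV[F]_d) := \sum_i x 0 i * y 0 i.
  have dotC x y : dot x y = dot y x by apply: eq_bigr => i _; rewrite mulrC.
  have dotP a x x' y : dot (a *: x + x') y = a * dot x y + dot x' y.
    by rewrite mulr_sumr -big_split; apply: eq_bigr => i _; rewrite !mxE /=; ring.
  have dot_nd w : w != 0 -> exists a, dot a w != 0.
    move=> /rV0Pn[i wi]; exists (delta_mx 0 i); rewrite /dot (bigD1 i) //= mxE !eqxx mul1r.
    by rewrite big1 ?addr0 // => j ji; rewrite mxE (negPf ji) mul0r.
  have [dchar dorth] := orth dot dotC dotP dot_nd.
  exists (fun a w => psi (dot a w)); split=> // a.
  have dot0 y : dot 0 y = 0 by rewrite /dot big1 // => i _; rewrite mxE mul0r.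
  apply: (le_trans (level_fourier_singular t radz z0 _ _ _)).
  - by rewrite dotC dot0.
  - by move=> x y; rewrite dotC -[x in x + y]scale1r dotP mul1r !(dotC a).
  - by move=> b x; rewrite dotC -[b *: x]addr0 dotP dot0 addr0 dotC.
  by rewrite ler_peMl ?exprn_ge0 ?sqrtC_ge0 ?ler0n // ler1n.
have rad0 y : radical y -> y = 0.
  move=> rady; apply/eqP; have := nrad y; rewrite negb_and negbK => /orP[//|/negP[]].
  by apply/(polar_trivialP _ (oner_neq0 _)).
have [|pchar porth] := orth (polar Q) (@polarC _ _ Q) (fun a x x' y => polarP a x x' y hQ).
  move=> w w0; apply/existsP; apply: contraNT w0 => /existsPn pw0.
  by apply/eqP/rad0 => x; apply/eqP; have := pw0 x; rewrite negbK.
by exists (fun a w => psi (polar Q a w)); split=> // a; apply: level_fourier_regular.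
Qed.

End QuadraticFourier.

(** * Energies *)

Lemma cauchy_schwarz_sum (I : finType) (x y : I -> algC) :
  (forall i, x i \is Num.real) -> (forall i, y i \is Num.real) ->
  (\sum_i x i * y i) ^+ 2 <= (\sum_i x i ^+ 2) * (\sum_i y i ^+ 2).
Proof.
move=> xr yr; set P := \sum_i x i * y i; set X := \sum_i _; set Y := \sum_i _.
have lagrange : \sum_i \sum_j (x i * y j - x j * y i) ^+ 2 = 2 * (X * Y - P ^+ 2).
  transitivity (\sum_i \sum_j (x i ^+ 2 * y j ^+ 2 + y i ^+ 2 * x j ^+ 2 -
                               2 * (x i * y i * (x j * y j)))).
    by apply: eq_bigr => i _; apply: eq_bigr => j _; ring.
  under eq_bigr do rewrite sumrB big_split /= -!mulr_sumr.
  by rewrite sumrB big_split /= -!mulr_sumr -!mulr_suml -/X -/Y -/P; ring.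
have : 0 <= 2 * (X * Y - P ^+ 2).
  rewrite -lagrange; apply: sumr_ge0 => i _; apply: sumr_ge0 => j _.
  by rewrite real_exprn_even_ge0 // rpredB ?rpredM.
by rewrite pmulr_rge0 ?ltr0n // subr_ge0.
Qed.

(** Up to the factor [#|V|], the bilinear sum is the sum over [a] of the products of the transforms
    of [phi], [f] and [g]. The first is at most [M]; Cauchy-Schwarz and Plancherel handle the other
    two. *)
Lemma fourier_bilinear_bound (V : finZmodType) (e : V -> V -> algC)
    (phi f g : V -> algC) (M : algC) :
  (forall a, is_addchar (e a)) ->
  (forall w, \sum_a e a w = if w == 0 then #|V|%:R else 0) ->
  (forall a, `|\sum_w phi w * e a w| <= M) ->
  `|\sum_u \sum_v f u * g v * phi (u + v)| ^+ 2 <=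
    M ^+ 2 * (\sum_u `|f u| ^+ 2) * (\sum_u `|g u| ^+ 2).
Proof.
move=> he orth phiM; pose hat (h : V -> algC) a := \sum_u h u * e a (- u).
have eD a x y : e a (x + y) = e a x * e a y by have [_ ->] := he a.
have n0 : 0 < #|V|%:R :> algC by rewrite ltr0n; apply/card_gt0P; exists 0.
have M0 : 0 <= M by apply: le_trans (phiM 0).
have orthS (h : V -> algC) v : \sum_u h u * (\sum_a e a (v - u)) = #|V|%:R * h v.
  rewrite (bigD1 v) //= subrr orth eqxx big1 ?addr0 1?mulrC // => u uv.
  by rewrite orth subr_eq0 eq_sym (negPf uv) mulr0.
have plancherel h : \sum_a `|hat h a| ^+ 2 = #|V|%:R * \sum_u `|h u| ^+ 2.
  transitivity (\sum_a \sum_v \sum_u (h v)^* * (h u * e a (v - u))).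
    apply: eq_bigr => a _; rewrite normCKC rmorph_sum mulr_suml; apply: eq_bigr => v _.
    rewrite mulr_sumr; apply: eq_bigr => u _; rewrite rmorphM /=.
    by rewrite -(addcharN _ (he a)) opprK eD; ring.
  rewrite exchange_big /= mulr_sumr; apply: eq_bigr => v _.
  rewrite exchange_big /=; under eq_bigr do rewrite -!mulr_sumr.
  by rewrite -mulr_sumr orthS normCKC mulrCA.
have TE : #|V|%:R * (\sum_u \sum_v f u * g v * phi (u + v)) =
    \sum_a (\sum_w phi w * e a w) * (hat f a * hat g a).
  transitivity (\sum_u \sum_v \sum_w \sum_a f u * g v * (phi w * e a ((u + v) - w))).
    rewrite mulr_sumr; apply: eq_bigr => u _; rewrite mulr_sumr; apply: eq_bigr => v _.
    under eq_bigr do rewrite -!mulr_sumr; rewrite -mulr_sumr orthS.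
    by rewrite mulrCA.
  (* Orthogonality does not see the sign of the argument; this sign pairs [phi w] with [e a w]. *)
  transitivity (\sum_u \sum_v \sum_w \sum_a f u * g v * (phi w * e a (w - (u + v)))).
    apply: eq_bigr => u _; apply: eq_bigr => v _; apply: eq_bigr => w _.
    rewrite -!mulr_sumr !orth; congr (_ * (_ * _)).
    by rewrite -opprB oppr_eq0.
  under eq_bigr => u _ do under eq_bigr => v _ do rewrite exchange_big /=.
  under eq_bigr => u _ do rewrite exchange_big /=.
  rewrite exchange_big /=; apply: eq_bigr => a _.
  rewrite mulrCA mulr_suml; apply: eq_bigr => u _.
  rewrite exchange_big /= mulr_suml mulr_sumr; apply: eq_bigr => w _.
  rewrite !mulr_sumr; apply: eq_bigr => v _.
  by rewrite opprD !eD; ring.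
rewrite -(ler_pM2l (exprn_gt0 2 n0)).
rewrite -[X in X ^+ 2 * `|_| ^+ 2](normr_nat algC) -exprMn -normrM TE.
have le1 : `|\sum_a (\sum_w phi w * e a w) * (hat f a * hat g a)| <=
    M * \sum_a `|hat f a| * `|hat g a|.
  rewrite mulr_sumr; apply: le_trans (ler_norm_sum _ _ _) _; apply: ler_sum => a _.
  by rewrite !normrM ler_wpM2r ?mulr_ge0.
apply: le_trans (lerXn2r 2 _ _ le1) _; rewrite ?nnegrE //.
  by rewrite mulr_ge0 // sumr_ge0 // => a _; rewrite mulr_ge0.
have := cauchy_schwarz_sum (fun a => normr_real (hat f a)) (fun a => normr_real (hat g a)).
rewrite !plancherel => cs; rewrite exprMn.
apply: le_trans (ler_wpM2l _ cs) _; first by rewrite exprn_ge0.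
by rewrite le_eqVlt; apply/orP; left; apply/eqP; ring.
Qed.

Definition rep_count (V : finZmodType) (m : nat) (E : {set V}) (v : V) : nat :=
  #|[pred x : {ffun 'I_m -> V} | [forall i, x i \in E] && (\sum_i x i == v)]|.

Lemma sum_rep_count (V : finZmodType) (m : nat) (E : {set V}) (R : nmodType) (h : V -> R) :
  \sum_(x : {ffun 'I_m -> V} | [forall i, x i \in E]) h (\sum_i x i) =
  \sum_v h v *+ rep_count m E v.
Proof.
rewrite (partition_big (fun x : {ffun 'I_m -> V} => \sum_i x i) xpredT) //=.
apply: eq_bigr => v _; rewrite /rep_count -sumr_const.
by apply: eq_big => [x|x /andP[_ /eqP ->]].
Qed.

Lemma sum_ffun_cat (V : finZmodType) (m n : nat) (E : {set V}) (R : nmodType)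
    (h : V -> V -> R) :
  \sum_(x : {ffun 'I_(m + n) -> V} | [forall i, x i \in E])
     h (\sum_(i < m) x (lshift n i)) (\sum_(i < n) x (rshift m i)) =
  \sum_u \sum_v h u v *+ (rep_count m E u * rep_count n E v).
Proof.
transitivity (\sum_(y : {ffun 'I_m -> V} | [forall i, y i \in E])
    \sum_(z : {ffun 'I_n -> V} | [forall i, z i \in E]) h (\sum_i y i) (\sum_i z i)).
  pose cat (p : {ffun 'I_m -> V} * {ffun 'I_n -> V}) : {ffun 'I_(m + n) -> V} :=
    [ffun i => match fintype.split i with inl j => p.1 j | inr j => p.2 j end].
  pose uncat (x : {ffun 'I_(m + n) -> V}) : {ffun 'I_m -> V} * {ffun 'I_n -> V} :=
    ([ffun i => x (lshift n i)], [ffun i => x (rshift m i)]).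
  have catl p i : cat p (lshift n i) = p.1 i by rewrite ffunE (unsplitK (inl i)).
  have catr p i : cat p (rshift m i) = p.2 i by rewrite ffunE (unsplitK (inr i)).
  have catK : cancel cat uncat.
    by case=> y z; congr (_, _); apply/ffunP => i; rewrite ffunE ?catl ?catr.
  have uncatK : cancel uncat cat.
    by move=> x; apply/ffunP => i; rewrite ffunE -{2}[i]splitK;
      case: fintype.split => j; rewrite ffunE.
  rewrite pair_big /= (reindex cat) /=; last by exists uncat => x _.
  apply: eq_big => [p|p _]; last first.
    by congr h; apply: eq_bigr => i _; rewrite ?catl ?catr.
  apply/forallP/andP => [pE|[/forallP yE /forallP zE] i].
    by split; apply/forallP => i; [rewrite -catl|rewrite -catr].
  by rewrite ffunE; case: fintype.split.
rewrite (sum_rep_count m E (fun u =>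
  \sum_(z : {ffun 'I_n -> V} | [forall i, z i \in E]) h u (\sum_i z i))).
apply: eq_bigr => u _; rewrite (sum_rep_count n E (h u)) -sumrMnl.
by apply: eq_bigr => v _; rewrite -mulrnA mulnC.
Qed.

Lemma energy_rep_count (V : finZmodType) (m : nat) (E : {set V}) :
  energy (m + m) E = (\sum_v rep_count m E v ^ 2)%N.
Proof.
have mm2 : (m + m)./2 = m by rewrite addnn doubleK.
transitivity (\sum_(x : {ffun 'I_(m + m) -> V} | [forall i, x i \in E])
   nat_of_bool (\sum_(i < m) x (lshift m i) == \sum_(i < m) x (rshift m i))%R)%N.
  rewrite /energy -sum1dep_card [RHS]big_mkcond [LHS]big_mkcond /=.
  apply: eq_bigr => x _; rewrite mm2; case: [forall i, _] => //=.
  rewrite [X in X == _]big_mkcond [X in _ == X]big_mkcond !big_split_ord /=.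
  rewrite [X in _ + X == _]big1 ?addr0 => [|i _]; last by rewrite ltnNge leq_addr.
  rewrite [X in _ == X + _]big1 ?add0r => [|i _]; last by rewrite leqNgt ltn_ord.
  under eq_bigr do rewrite ltn_ord.
  under [X in _ == X]eq_bigr do rewrite leq_addr.
  by case: eqP.
rewrite (sum_ffun_cat m m E (fun u v => nat_of_bool (u == v))).
apply: eq_bigr => u _; rewrite (bigD1 u) //= eqxx big1 => [|v /negPf].
  by rewrite addr0 natn mulnn.
by rewrite eq_sym => ->; rewrite mul0rn.
Qed.

Lemma sum_rep_count1 (V : finZmodType) (m : nat) (E : {set V}) :
  (\sum_v rep_count m E v = #|E| ^ m)%N.
Proof.
have := sum_rep_count m E (fun=> 1%N).
rewrite sum1dep_card => cardE; transitivity (\sum_v 1%N *+ rep_count m E v).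
  by apply: eq_bigr => v _; rewrite -[LHS]natn.
rewrite -cardE -[m in RHS]card_ord -(card_ffun_on 'I_m (mem E)).
by apply: eq_card => x; rewrite inE; apply/forallP/ffun_onP.
Qed.

(** * Counting on a level set, with an explicit error term *)

Lemma level_count_rep_count (F : finFieldType) (d m n : nat) (Q : 'rV[F]_d -> F)
    (t : F) (E : {set 'rV[F]_d}) :
  level_count (m + n) Q t E =
  (\sum_u \sum_v (Q (u + v)%R == t) * (rep_count m E u * rep_count n E v))%N.
Proof.
transitivity (\sum_(x : {ffun 'I_(m + n) -> 'rV[F]_d} | [forall i, x i \in E])
   nat_of_bool (Q (\sum_(i < m) x (lshift n i) + \sum_(i < n) x (rshift m i)) == t)%R)%N.
  rewrite /level_count -sum1dep_card [RHS]big_mkcond [LHS]big_mkcond /=.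
  by apply: eq_bigr => x _; rewrite big_split_ord; case: [forall i, _] => //=; case: eqP.
rewrite (sum_ffun_cat m n E (fun u v => nat_of_bool (Q (u + v) == t))).
apply: eq_bigr => u _; apply: eq_bigr => v _; by rewrite -mulr_natr natn.
Qed.

Lemma level_count_le (F : finFieldType) (d m n : nat) (Q : 'rV[F]_d -> F)
    (t : F) (E : {set 'rV[F]_d}) :
  (level_count (m + n) Q t E <= #|E| ^ (m + n))%N.
Proof.
rewrite level_count_rep_count expnD -!sum_rep_count1 big_distrl /=.
apply: leq_sum => u _; rewrite big_distrr /=; apply: leq_sum => v _.
by case: eqP; rewrite ?mul1n.
Qed.

(** Squaring makes both sides integers, so a bound proved in [algC] can be carried over to any
    [realType]. The factor 36 is the square of the 6 in [level_fourier_bound]. *)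
Lemma level_count_error (F : finFieldType) (d m n : nat) (Q : 'rV[F]_d -> F)
    (t : F) (E : {set 'rV[F]_d}) :
  is_quadratic_form Q -> nondegenerate_form Q -> t != 0 ->
  ((#|F| * level_count (m + n) Q t E)%:Z - (#|E| ^ (m + n))%:Z) ^+ 2 <=
  (36 * #|F| ^ d.+1 * energy (m + m) E * energy (n + n) E)%:Z.
Proof.
move=> hQ ndQ t0; set z := _ - _; have [psi hpsi psi_nontriv] := exists_nontrivial_addchar F.
have [e [he orth bound]] := level_fourier_bound hQ ndQ hpsi psi_nontriv t0.
rewrite -card_rVE in orth.
have := fourier_bilinear_bound (fun u => (rep_count m E u)%:R)
  (fun v => (rep_count n E v)%:R) he orth bound.
have -> : \sum_u \sum_v (rep_count m E u)%:R * (rep_count n E v)%:R *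
    (#|F|%:R * (Q (u + v) == t)%:R - 1) =
    z%:~R :> algC.
  rewrite /z rmorphB /= -!pmulrn level_count_rep_count expnD -!sum_rep_count1.
  rewrite !natrM !natr_sum mulr_sumr mulr_suml -sumrB; apply: eq_bigr => u _.
  rewrite natr_sum !mulr_sumr -sumrB; apply: eq_bigr => v _.
  by rewrite !natrM; ring.
have sumsq k : \sum_u `|(rep_count k E u)%:R : algC| ^+ 2 = (energy (k + k) E)%:R.
  rewrite energy_rep_count natr_sum; apply: eq_bigr => u _.
  by rewrite normr_nat natrX.
rewrite !sumsq real_normK ?Rreal_int // exprMn exprAC sqrtCK.
rewrite -(ler_int algC) rmorphXn /= => le1; apply: le_trans le1 _.
rewrite -pmulrn !natrM natrX le_eqVlt; apply/orP; left; apply/eqP; ring.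
Qed.

(** * From the error term to the asymptotic formula *)

Lemma asymp_eq_of_error (R : realType) (N X Y q : nat -> R) :
  (forall n, 0 <= X n) -> (forall n, 0 <= Y n) -> (forall n, 0 < q n) ->
  (forall n, Y n = 0 -> N n = 0) ->
  (forall n, (q n * N n - Y n) ^+ 2 <= (6 * X n) ^+ 2) ->
  little_o X Y -> asymp_eq N (fun n => Y n / q n).
Proof.
move=> X0 Y0 q0 NY err o_XY.
(* The witness is the relative error. Where [Y n = 0] the quotient is 0 by convention, and the
   identity holds because [N n = 0] there. *)
exists (fun n => (q n * N n - Y n) / Y n); last first.
  move=> n; have [Yn|Yn] := eqVneq (Y n) 0; first by rewrite NY // Yn mul0r mulr0.
  by field; rewrite Yn gt_eqF.
apply/norm_cvg0P.
have o6 : (6 * (X n / Y n) @[n --> \oo] --> (0 : R))%classic.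
  by rewrite -(mulr0 6); apply: cvgM => //; apply: cvg_cst.
apply: (squeeze_cvgr _ (cvg_cst 0) o6).
near=> n; rewrite normr_ge0 /= normrM normfV (ger0_norm (Y0 n)) mulrA.
rewrite ler_wpM2r ?invr_ge0 //.
rewrite -(@ler_pXn2r _ 2) ?nnegrE ?mulr_ge0 //.
by rewrite real_normK ?num_real.
Unshelve. all: by end_near.
Qed.

Lemma sqr_powR_half (R : realType) (a x : R) : 0 <= a -> (a `^ (x / 2)) ^+ 2 = a `^ x.
Proof.
by move=> a0; rewrite -powR_mulrn ?powR_ge0 // -powRrM divfK.
Qed.

Lemma level_count_error_real (R : realType) (F : finFieldType) (d m n : nat)
    (Q : 'rV[F]_d -> F) (t : F) (E : {set 'rV[F]_d}) :
  is_quadratic_form Q -> nondegenerate_form Q -> t != 0 ->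
  (#|F|%:R * (level_count (m + n) Q t E)%:R - #|E|%:R ^+ (m + n)) ^+ 2 <=
  36 * ((#|F|%:R `^ d.+1%:R) * (energy (m + m) E)%:R * (energy (n + n) E)%:R) :> R.
Proof.
move=> hQ ndQ t0; have := level_count_error m n E hQ ndQ t0.
set z := _ - _; rewrite -(ler_int R) rmorphXn /= /z rmorphB /= -!pmulrn.
by rewrite powR_mulrn // !natrM !natrX !mulrA.
Qed.

(** Prescribing only the square of [X] lets both parities of [k] be instances, with their different
    roots of energies. *)
Lemma asymp_eq_level_count (R : realType) (d m n : nat) (F : nat -> finFieldType)
    (Q : forall i, 'rV[F i]_d -> F i) (t : forall i, F i)
    (E : forall i, {set 'rV[F i]_d}) (X : nat -> R) :
  (forall i, is_quadratic_form (Q i)) -> (forall i, nondegenerate_form (Q i)) ->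
  (forall i, t i != 0) -> (forall i, 0 <= X i) ->
  (forall i, X i ^+ 2 = (#|F i|%:R `^ d.+1%:R) *
     (energy (m + m) (E i))%:R * (energy (n + n) (E i))%:R) ->
  little_o X (fun i => #|E i|%:R ^+ (m + n)) ->
  asymp_eq (fun i => (level_count (m + n) (Q i) (t i) (E i))%:R : R)
           (fun i => #|E i|%:R ^+ (m + n) / #|F i|%:R).
Proof.
move=> hQ hQnd ht X0 X2; apply: asymp_eq_of_error => // i.
- by rewrite ltr0n ltnW // finNzRing_gt1.
- move=> En; apply/eqP; rewrite pnatr_eq0 -leqn0.
  apply: leq_trans (level_count_le _ _ _ _ _) _.
  by rewrite leqn0 -(pnatr_eq0 R) natrX En.
- rewrite exprMn X2 (_ : 6 ^+ 2 = 36); first exact: level_count_error_real.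
  by ring.
Qed.

Theorem theorem4p4 (R : realType) (d k : nat) (hk : (2 <= k)%N)
  (F : nat -> finFieldType)
  (hF : (#|F n| @[n --> \oo] --> \oo)%classic)
  (Q : forall n, 'rV[F n]_d -> F n)
  (hQ : forall n, is_quadratic_form (Q n))
  (hQnd : forall n, nondegenerate_form (Q n))
  (t : forall n, F n) (ht : forall n, t n != 0)
  (E : forall n, {set 'rV[F n]_d}) :
  (~~ odd k ->
   little_o
     (fun n => (#|F n|%:R : R) `^ (d.+1%:R / 2) * (energy k (E n))%:R)
     (fun n => #|E n|%:R ^+ k) ->
   asymp_eq (fun n => (level_count k (Q n) (t n) (E n))%:R : R)
            (fun n => #|E n|%:R ^+ k / #|F n|%:R))
  /\
  (odd k ->
   little_o
     (fun n => (#|F n|%:R : R) `^ (d.+1%:R / 2)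
               * (energy k.-1 (E n))%:R `^ (1 / 2)
               * (energy k.+1 (E n))%:R `^ (1 / 2))
     (fun n => #|E n|%:R ^+ k) ->
   asymp_eq (fun n => (level_count k (Q n) (t n) (E n))%:R : R)
            (fun n => #|E n|%:R ^+ k / #|F n|%:R)).
Proof.
split=> [k_even|k_odd] hX.
  (* For even [k] the cut into equal halves makes the product of energies the square of
     [energy k]. *)
  have kE : k = (k./2 + k./2)%N by rewrite addnn -[LHS]odd_double_half (negPf k_even).
  move: (k./2) kE hX => m -> hX.
  apply: asymp_eq_level_count hX => // i.
  by rewrite /= exprMn sqr_powR_half // expr2 mulrA.
(* For odd [k] the parts [m] and [m.+1] produce the energies of orders [k.-1] and [k.+1]. *)
have kE : k = (k./2 + k./2.+1)%N by rewrite addnS addnn -[LHS]odd_double_half k_odd.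
move: (k./2) kE hX => m ->.
have -> : ((m + m.+1).-1 = m + m)%N by rewrite addnS.
have -> : ((m + m.+1).+1 = m.+1 + m.+1)%N by rewrite addSn.
move=> hX; apply: asymp_eq_level_count hX => // i.
by rewrite /= !exprMn !sqr_powR_half // !powRr1.
Qed.
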